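(* Let $C_{\mathbb{Q}}$ be a smooth, proper, geometrically integral curve over $\mathbb{Q}$ of genus $g\ge 2$, let $p>2$ be a prime of good reduction, let $C/\mathbb{Z}_{(p)}$ be a smooth proper model and $J/\mathbb{Z}_{(p)}$ its Jacobian, and assume the Mordell--Weil rank $r$ of $J(\mathbb{Z}_{(p)})=J_{\mathbb{Q}}(\mathbb{Q})$ satisfies $r<g$. Fix a basepoint $b\in C(\mathbb{Z}_{(p)})$. Then \[ C(\mathbb{Z}_{(p)}) \subseteq C(\mathbb{Z}_p)_{\mathrm{GLC}} \subseteq C(\mathbb{Z}_p)_{\mathrm{CC}}. \] Furthermore, for every point $R\in C(\mathbb{Z}_p)_{\mathrm{CC}}\setminus C(\mathbb{Z}_p)_{\mathrm{GLC}}$, one of the following holds: (1) the point $\overline{R}$ fails the Mordell--Weil sieve at $p$, i.e. the image of $R-b$ in $J(\mathbb{F}_p)$ is not contained in the image of $M$ in $J(\mathbb{F}_p)$; or (2) for $T\in J(\mathbb{Z}_{(p)})_{\overline{R}-\overline{b}}$, the element $\log(R-b-T)$ does not lie in the $\mathbb{Z}_p$-submodule $\log M_0$ of $H^0(J_{\mathbb{Z}_p},\Omega^1_{J_{\mathbb{Z}_p}})^\vee$, but only in its $p$-saturation $\log N_0$.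
   Context: Notation: $\mathrm{AJ}_b\colon C(\mathbb{Z}_p)\to J(\mathbb{Z}_p)$, $P\mapsto [P-b]$, is the Abel--Jacobi map. For a scheme $X$, a local ring $R$ with residue field $\mathbb{F}_p$ and $Q\in X(\mathbb{F}_p)$, $X(R)_Q=\{x\in X(R):\bar x=Q\}$ is the residue disk; the same notation is used for subsets of $J(\mathbb{Z}_p)$. $M$ denotes the $p$-adic closure of $J(\mathbb{Z}_{(p)})$ in $J(\mathbb{Z}_p)$, $r'$ the $\mathbb{Z}_p$-rank of $M/M^{\mathrm{tors}}$, $M_0=M\cap J(\mathbb{Z}_p)_0$ its kernel of reduction, and $N_0=\{x\in J(\mathbb{Z}_p)_0: p^kx\in M_0\text{ for some }k\ge0\}$ the $p$-saturation of $M_0$ in $J(\mathbb{Z}_p)_0$. The logarithm $\log\colon J(\mathbb{Z}_p)_0\to H^0(J_{\mathbb{Z}_p},\Omega^1_{J_{\mathbb{Z}_p}})^\vee$ (dual as $\mathbb{Z}_p$-module) is $x\mapsto(\omega\mapsto \frac1p\int_0^x\omega)$ (normalized Coleman integral); it is an isomorphism of groups for $p>2$, and extends to $J(\mathbb{Z}_p)$ by $\log(j)=\frac1m\log(mj)$ with $m$ the exponent of $J(\mathbb{F}_p)$. A point $Q\in C(\mathbb{F}_p)$ passes the Mordell--Weil sieve at $p$ if $Q-\overline b\in J(\mathbb{F}_p)$ lies in the image of $J(\mathbb{Z}_{(p)})\to J(\mathbb{F}_p)$, equivalently $J(\mathbb{Z}_{(p)})_{Q-\overline b}\neq\emptyset$.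 The Chabauty--Coleman set is $C(\mathbb{Z}_p)_{\mathrm{CC}}=\{P\in C(\mathbb{Z}_p): \frac1p\int_0^{P-b}\nu=0\text{ for all }\nu\in V\}$, where $V=\{\nu\in H^0(J_{\mathbb{Z}_p},\Omega^1_{J_{\mathbb{Z}_p}}): \frac1p\int_0^m\nu=0\ \forall m\in M\}$ (a rank $g-r'$ module). The geometric linear Chabauty set $C(\mathbb{Z}_p)_{\mathrm{GLC}}$ is the union, over $Q\in C(\mathbb{F}_p)$ with $J(\mathbb{Z}_{(p)})_{Q-\overline b}\neq\emptyset$, of the sets of $P\in C(\mathbb{Z}_p)_Q$ with $\mathrm{AJ}_b(P)\in M_{Q-\overline b}$ (in Spelier's construction these are the zero sets of the power series $\lambda^Q_{\mathrm{GLC}}$ on $M_{Q-\overline b}$ obtained by pulling back equations cutting out $\mathrm{AJ}_b(C(\mathbb{Z}_p)_Q)$ in $J(\mathbb{Z}_p)_{Q-\overline b}$). *)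

(* Defs.v *)
From HB Require Import structures.
From mathcomp Require Import all_boot all_order all_algebra all_field.
From mathcomp Require Import fraction.
From mathcomp Require Export mpoly.
Set Implicit Arguments.
Unset Strict Implicit.
Unset Printing Implicit Defensive.
Import GRing.Theory.
Local Open Scope ring_scope.

Definition pdvd (p : nat) (A : comNzRingType) (k : nat) (x : A) : Prop :=
  exists y, x = p%:R ^+ k * y.

(* Z_p, together with its residue map, is determined up to unique isomorphism
   as the p-torsion-free, p-adically separated and complete ring with residue
   ring F_p.  Q_p is {fraction Zp}. *)
Definition is_padic_integers (p : nat) (Zp : idomainType)
    (red : {rmorphism Zp -> 'F_p}) : Prop :=
  [/\ p%:R != 0 :> Zp,
      forall x, red x = 0 <-> pdvd p 1 x,
      forall x : Zp, (forall k, pdvd p k x) -> x = 0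
    & forall u : nat -> Zp, (forall k, pdvd p k (u k.+1 - u k)) ->
        exists l, forall k, pdvd p k (l - u k)].

Definition homogeneous (R : nzRingType) n (f : {mpoly R[n]}) : Prop :=
  exists d, f \is d.-homog.

(* A projective Z_(p)-scheme X in P^n is given by homogeneous equations with
   coefficients in int (denominators prime to p may be cleared).  It is used
   through its functor of points on local Z_(p)-algebras A: X(A) is the set of
   solutions in A^(n+1) with an invertible coordinate, up to units. *)
Definition local_algebra (p : nat) (A : comUnitRingType) : Prop :=
  (forall x y : A, x + y \is a GRing.unit ->
     x \is a GRing.unit \/ y \is a GRing.unit) /\
  (forall q : nat, coprime q p -> q%:R \is a @GRing.unit A).

Definition primitive (A : comUnitRingType) n (x : 'rV[A]_n) : bool :=
  [exists i, x 0 i \is a GRing.unit].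

Definition proj_eq (A : comUnitRingType) n (x y : 'rV[A]_n) : bool :=
  [forall i, forall j, x 0 i * y 0 j == x 0 j * y 0 i].

Definition ev (R A : nzRingType) n (phi : R -> A) (x : 'rV[A]_n)
  (f : {mpoly R[n]}) : A := mmap phi (fun i => x 0 i) f.

Definition intmx (A : nzRingType) n (z : 'rV[int]_n) : 'rV[A]_n :=
  map_mx intr z.

Definition point n (X : seq {mpoly int[n]}) (A : comUnitRingType)
    (x : 'rV[A]_n) : Prop :=
  primitive x /\ (forall f, f \in X -> ev intr x f = 0).
Arguments point {n} X A x.

(* X(Z_(p)), described by integral homogeneous coordinates *)
Definition zpoint (p n : nat) (X : seq {mpoly int[n]}) (z : 'rV[int]_n) : Prop :=
  (exists i, ~~ (p%:Z %| z ord0 i)%Z) /\ (forall f, f \in X -> ev intr z f = 0).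

Definition in_ideal (R : comNzRingType) n (s : seq {mpoly R[n]})
    (f : {mpoly R[n]}) : Prop :=
  exists c : 'I_(size s) -> {mpoly R[n]}, f = \sum_i c i * s`_i.

(* At every point, X is locally cut out by n - d of its equations, with
   linearly independent differentials. *)
Definition smooth_proj (p d n : nat) (X : seq {mpoly int[n.+1]}) : Prop :=
  [/\ (d <= n)%N,
      forall f, f \in X -> homogeneous f
    & forall (k : fieldType) (x : 'rV[k]_n.+1), local_algebra p k ->
      point X k x ->
      exists (g : 'I_(n - d) -> {mpoly int[n.+1]}) (h : {mpoly int[n.+1]}),
      [/\ forall i, homogeneous (g i) /\ in_ideal X (g i),
          row_free (\matrix_(i < n - d, j < n.+1) ev intr x (mderiv j (g i))),
          homogeneous h, ev intr x h != 0
        & forall f, f \in X -> in_ideal [seq g i | i <- enum 'I_(n - d)] (h * f)]].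

Definition irreducible_over n (X : seq {mpoly int[n]}) (k : closedFieldType) :
    Prop :=
  (exists x, point X k x) /\
  (forall f g : {mpoly k[n]},
     homogeneous f -> homogeneous g ->
     (forall x, point X k x -> ev id x f * ev id x g = 0) ->
     (forall x, point X k x -> ev id x f = 0) \/
     (forall x, point X k x -> ev id x g = 0)).

(* Morphisms are glued from tuples of forms (bihomogeneous forms when the
   source is a product); a tuple is used where its value is primitive. *)
Definition morphism (a b : nat) := seq (b.-tuple {mpoly int[a]}).

Definition mor_at a b (A : comUnitRingType) (t : b.-tuple {mpoly int[a]})
  (x : 'rV[A]_a) : 'rV[A]_b := \row_j ev intr x (tnth t j).

Definition mor_val a b (F : morphism a b) (A : comUnitRingType)
    (x : 'rV[A]_a) (y : 'rV[A]_b) : Prop :=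
  primitive y /\
  exists t, [/\ t \in F, primitive (mor_at t x) & proj_eq (mor_at t x) y].

Definition is_morphism (p a b : nat)
    (dom : forall A : comUnitRingType, 'rV[A]_a -> Prop)
    (Y : seq {mpoly int[b]}) (F : morphism a b) : Prop :=
  forall (A : comUnitRingType) (x : 'rV[A]_a), local_algebra p A -> dom A x ->
  [/\ exists2 t, t \in F & primitive (mor_at t x),
      forall t, t \in F -> primitive (mor_at t x) -> point Y A (mor_at t x)
    & forall t u, t \in F -> u \in F -> primitive (mor_at t x) ->
        primitive (mor_at u x) -> proj_eq (mor_at t x) (mor_at u x)].

Definition proj_morphism (p a b : nat) (X : seq {mpoly int[a]})
    (Y : seq {mpoly int[b]}) (F : morphism a b) : Prop :=
  (forall t, t \in F -> exists d, forall j, tnth t j \is d.-homog) /\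
  is_morphism p (point X) Y F.

Definition bihomog a1 a2 (d1 d2 : nat) (f : {mpoly int[a1 + a2]}) : Prop :=
  forall mm, mm \in msupp f ->
    (\sum_(i < a1) mm (lshift a2 i) = d1)%N /\
    (\sum_(i < a2) mm (rshift a1 i) = d2)%N.

Definition pair_point a1 a2 (X1 : seq {mpoly int[a1]}) (X2 : seq {mpoly int[a2]})
    (A : comUnitRingType) (x : 'rV[A]_(a1 + a2)) : Prop :=
  point X1 A (lsubmx x) /\ point X2 A (rsubmx x).

Definition biproj_morphism (p a1 a2 b : nat) (X1 : seq {mpoly int[a1]})
    (X2 : seq {mpoly int[a2]}) (Y : seq {mpoly int[b]})
    (F : morphism (a1 + a2) b) : Prop :=
  (forall t, t \in F -> exists d1 d2, forall j, bihomog d1 d2 (tnth t j)) /\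
  is_morphism p (@pair_point a1 a2 X1 X2) Y F.

Record group_data (m : nat) := GroupData {
  geqs : seq {mpoly int[m.+1]};
  gone : 'rV[int]_m.+1;
  gadd : morphism (m.+1 + m.+1) m.+1;
  gopp : morphism m.+1 m.+1 }.

(* add_rel J x y z means x + y = z, and sum_rel J s z means that the sum of
   the list s is z. *)
Definition add_rel m (J : group_data m) (A : comUnitRingType)
  (x y z : 'rV[A]_m.+1) : Prop := mor_val (gadd J) (row_mx x y) z.

Fixpoint sum_rel m (J : group_data m) (A : comUnitRingType)
    (s : seq 'rV[A]_m.+1) (z : 'rV[A]_m.+1) : Prop :=
  match s with
  | [::] => primitive z /\ proj_eq (intmx A (gone J)) z
  | x :: s' => exists2 y, sum_rel J s' y & add_rel J x y z
  end.

Definition abelian_scheme (p g m : nat) (J : group_data m) : Prop :=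
  [/\ smooth_proj p g (geqs J) /\
      (forall k : closedFieldType, local_algebra p k ->
         irreducible_over (geqs J) k),
      zpoint p (geqs J) (gone J),
      biproj_morphism p (geqs J) (geqs J) (geqs J) (gadd J),
      proj_morphism p (geqs J) (geqs J) (gopp J)
    & forall A : comUnitRingType, local_algebra p A ->
      [/\ forall x, point (geqs J) A x -> add_rel J (intmx A (gone J)) x x,
          forall x y, point (geqs J) A x -> mor_val (gopp J) x y ->
            add_rel J y x (intmx A (gone J)),
          forall x y z, point (geqs J) A x -> point (geqs J) A y ->
            add_rel J x y z -> add_rel J y x z
        & forall x y z u v w, point (geqs J) A x -> point (geqs J) A y ->
            point (geqs J) A z -> add_rel J x y u -> add_rel J u z w ->
            add_rel J y z v -> add_rel J x v w]].

(* Order of vanishing at P of a form F on the curve X over algC: F lies in the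
   n-th power of the maximal ideal of the local ring at P iff some multiple
   H * F with H(P) <> 0 lies in I(X) + I(P)^n, where I(P) is generated by the
   2x2 minors of (P, 'X). *)
Definition minor_at n (P : 'rV[algC]_n) (ij : 'I_n * 'I_n) : {mpoly algC[n]} :=
  P 0 ij.1 *: 'X_ij.2 - P 0 ij.2 *: 'X_ij.1.

Definition ord_ge n (X : seq {mpoly int[n]}) (P : 'rV[algC]_n)
    (F : {mpoly algC[n]}) (e : nat) : Prop :=
  exists H : {mpoly algC[n]},
  [/\ homogeneous H, ev id P H != 0
    & in_ideal ([seq map_mpoly intr f | f <- X] ++
        [seq \prod_(i < e) minor_at P (s i) | s : {ffun 'I_e -> 'I_n * 'I_n}])
        (H * F)].

Definition ord_eq n (X : seq {mpoly int[n]}) P (F : {mpoly algC[n]}) e : Prop :=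
  ord_ge X P F e /\ ~ ord_ge X P F e.+1.

Definition points n (X : seq {mpoly int[n]}) (A : comUnitRingType)
  (s : seq 'rV[A]_n) : Prop := forall x, x \in s -> point X A x.

(* The effective divisors s and t satisfy s - t = div (F / G). *)
Definition lin_equiv n (X : seq {mpoly int[n]}) (s t : seq 'rV[algC]_n) : Prop :=
  exists (d : nat) (F G : {mpoly algC[n]}),
  [/\ F \is d.-homog, G \is d.-homog
    & forall P, point X algC P -> exists a b,
      [/\ ord_eq X P F a, ord_eq X P G b
        & (a + count (proj_eq P) t = b + count (proj_eq P) s)%N]].

Definition aj_sum n m (J : group_data m) (aj : morphism n m.+1)
    (A : comUnitRingType) (s : seq 'rV[A]_n) (z : 'rV[A]_m.+1) : Prop :=
  exists a : seq 'rV[A]_m.+1,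
  [/\ size a = size s,
      forall i, (i < size s)%N -> mor_val aj s`_i a`_i
    & sum_rel J a z].

(* The abelian scheme J is the Jacobian of C with Abel-Jacobi map
   P |-> [P - b]: over the algebraic closure of Q, the additive extension of aj
   to divisors identifies Pic^0 with J.  As J is the Neron model of its generic
   fibre, this determines J over Z_(p). *)
Definition is_jacobian (p n m : nat) (C : seq {mpoly int[n]}) (b : 'rV[int]_n)
    (J : group_data m) (aj : morphism n m.+1) : Prop :=
  [/\ proj_morphism p C (geqs J) aj,
      forall A : comUnitRingType, local_algebra p A ->
        mor_val aj (intmx A b) (intmx A (gone J)),
      forall s t : seq 'rV[algC]_n, points C s -> points C t ->
        size s = size t ->
        ((exists2 z, aj_sum J aj s z & aj_sum J aj t z) <-> lin_equiv C s t)
    & forall z, point (geqs J) algC z ->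
        exists (s t : seq 'rV[algC]_n) (u w : 'rV[algC]_m.+1),
        [/\ points C s /\ points C t, size s = size t, aj_sum J aj s u,
            aj_sum J aj t w & add_rel J z w u]].

(* Global sections of Omega^1 on X_B.  A chart (H, (F_i)) stands for the form
   (\sum_i F_i dX_i) / H on the locus H <> 0; the condition
   \sum_i X_i F_i = 0 says that it descends from the cone to X. *)
Definition tangent n (X : seq {mpoly int[n]}) (A : comUnitRingType)
    (x v : 'rV[A]_n) : Prop :=
  forall f, f \in X -> \sum_i ev intr x (mderiv i f) * v 0 i = 0.

Definition chart (B : comNzRingType) (n : nat) : Type :=
  ({mpoly B[n]} * n.-tuple {mpoly B[n]})%type.

Definition chart_val (B : comNzRingType) n (A : comUnitRingType) (phi : B -> A)
    (c : chart B n) (x v : 'rV[A]_n) : A :=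
  (\sum_i ev phi x (tnth c.2 i) * v 0 i) / ev phi x c.1.

Definition is_form (p n : nat) (X : seq {mpoly int[n]}) (B : comNzRingType)
    (w : seq (chart B n)) : Prop :=
  (forall c, c \in w -> exists d,
     c.1 \is d.+1.-homog /\ forall i, tnth c.2 i \is d.-homog) /\
  (forall (A : comUnitRingType) (phi : {rmorphism B -> A}) (x : 'rV[A]_n),
     local_algebra p A -> point X A x ->
     [/\ exists2 c, c \in w & ev phi x c.1 \is a GRing.unit,
         forall c, c \in w -> ev phi x c.1 \is a GRing.unit ->
           chart_val phi c x x = 0
       & forall c c', c \in w -> c' \in w -> ev phi x c.1 \is a GRing.unit ->
           ev phi x c'.1 \is a GRing.unit ->
           forall v, tangent X x v -> chart_val phi c x v = chart_val phi c' x v]).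

Record regular_form (p n : nat) (X : seq {mpoly int[n]}) (B : comNzRingType) :=
  RegularForm {
  charts :> seq (chart B n);
  chartsP : is_form p X charts }.

(* The g forms w_i are a basis of H^0(X_Q, Omega^1); equality of forms on X_Q
   may be tested on points and tangent vectors over algC. *)
Definition genus (p n : nat) (X : seq {mpoly int[n]}) (g : nat) : Prop :=
  exists w : 'I_g -> regular_form p X rat, forall eta : regular_form p X rat,
  exists! a : {ffun 'I_g -> rat},
  forall x v : 'rV[algC]_n, point X algC x -> tangent X x v ->
  forall (c0 : chart rat n) (c : 'I_g -> chart rat n),
    c0 \in charts eta -> ev ratr x c0.1 != 0 ->
    (forall i, c i \in charts (w i) /\ ev ratr x (c i).1 != 0) ->
    chart_val ratr c0 x v = \sum_i ratr (a i) * chart_val ratr (c i) x v.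

Section PadicPoints.
Variables (p n m : nat) (Zp : idomainType) (red : {rmorphism Zp -> 'F_p}).
Variables (C : seq {mpoly int[n.+1]}) (b : 'rV[int]_n.+1).
Variables (J : group_data m) (aj : morphism n.+1 m.+1).

Definition Qp := {fraction Zp}.

Definition reduces_to k (x : 'rV[Zp]_k) (Q : 'rV['F_p]_k) : Prop :=
  proj_eq (map_mx red x) Q.

(* The image of X(Z_(p)) in X(Z_p) *)
Definition rational_point k (X : seq {mpoly int[k]}) (x : 'rV[Zp]_k) : Prop :=
  point X Zp x /\ exists2 z, zpoint p X z & proj_eq x (intmx Zp z).

Definition padic_close k (e : nat) (x y : 'rV[Zp]_k) : Prop :=
  forall i j, pdvd p e (x 0 i * y 0 j - x 0 j * y 0 i).

Definition M (x : 'rV[Zp]_m.+1) : Prop :=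
  point (geqs J) Zp x /\
  forall e, exists2 T, rational_point (geqs J) T & padic_close e x T.

Definition J0 (x : 'rV[Zp]_m.+1) : Prop :=
  point (geqs J) Zp x /\ reduces_to x (intmx _ (gone J)).

Definition M0 x : Prop := M x /\ J0 x.

Definition N0 x : Prop :=
  J0 x /\ exists (k : nat) (y : 'rV[Zp]_m.+1),
            sum_rel J (nseq (p ^ k) x) y /\ M0 y.

Definition combination r (T : 'I_r -> 'rV[Zp]_m.+1) (a : 'I_r -> nat) :=
  flatten [seq nseq (a i) (T i) | i <- enum 'I_r].

(* The T_i form a maximal Z-linearly independent family in J(Z_(p)); integral
   relations are written with natural coefficients on both sides. *)
Definition mw_rank (r : nat) : Prop :=
  exists T : 'I_r -> 'rV[Zp]_m.+1,
  [/\ forall i, rational_point (geqs J) (T i),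
      forall a c z, sum_rel J (combination T a) z ->
        sum_rel J (combination T c) z -> a =1 c
    & forall x, rational_point (geqs J) x -> exists (k : nat) a c z,
        [/\ (0 < k)%N, sum_rel J (nseq k x ++ combination T a) z
          & sum_rel J (combination T c) z]].

(* On J, the Coleman integral x |-> \int_0^x w is the homomorphism
   J(Z_p) -> Q_p with differential w (unique, since J(Z_p) is a compact p-adic
   Lie group).  Near x, points are written x + p^k v, and
   \int_0^(x + p^k v) w - \int_0^x w = p^k w_x(v) + o(p^k), uniformly in v. *)
Definition is_coleman_integral (w : regular_form p (geqs J) Zp)
    (lam : 'rV[Zp]_m.+1 -> Qp) : Prop :=
  (forall x y z, point (geqs J) Zp x -> point (geqs J) Zp y ->
     add_rel J x y z -> lam z = lam x + lam y) /\
  (forall x c, point (geqs J) Zp x -> c \in charts w ->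
     ev id x c.1 \is a GRing.unit ->
     forall e : nat, exists K : nat, forall (k : nat) (v : 'rV[Zp]_m.+1),
       (K <= k)%N -> point (geqs J) Zp (x + p%:R ^+ k *: v) ->
       exists u : Zp, lam (x + p%:R ^+ k *: v) - lam x =
         tofrac (p%:R ^+ k * chart_val id c x v + p%:R ^+ (k + e) * u)).

Variable integral : regular_form p (geqs J) Zp -> 'rV[Zp]_m.+1 -> Qp.

(* The values on J(Z_p)_0 of this functional lie in Z_p. *)
Definition padic_log (x : 'rV[Zp]_m.+1) (w : regular_form p (geqs J) Zp) : Qp :=
  p%:R^-1 * integral w x.

Definition in_log (S : 'rV[Zp]_m.+1 -> Prop)
    (l : regular_form p (geqs J) Zp -> Qp) : Prop :=
  exists2 x, S x & l =1 padic_log x.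

Definition V (nu : regular_form p (geqs J) Zp) : Prop :=
  forall x, M x -> p%:R^-1 * integral nu x = 0.

Definition CC (P : 'rV[Zp]_n.+1) : Prop :=
  point C Zp P /\
  forall nu j, V nu -> mor_val aj P j -> p%:R^-1 * integral nu j = 0.

(* Here q plays the role of Q - b in J(F_p). *)
Definition GLC (P : 'rV[Zp]_n.+1) : Prop :=
  exists (Q : 'rV['F_p]_n.+1) (q : 'rV['F_p]_m.+1),
  [/\ point C 'F_p Q /\ mor_val aj Q q,
      exists2 T, rational_point (geqs J) T & reduces_to T q,
      point C Zp P /\ reduces_to P Q
    & exists2 j, mor_val aj P j & M j /\ reduces_to j q].

End PadicPoints.

(* Main.v *)
Require Import Defs.
From HB Require Import structures.
From mathcomp Require Import all_boot all_order all_algebra all_field.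
From mathcomp Require Import fraction generic_quotient ring.
From Stdlib Require Import Classical_Prop.
Set Implicit Arguments.
Unset Strict Implicit.
Unset Printing Implicit Defensive.
Import GRing.Theory.
Local Open Scope ring_scope.

(* The first inclusion is functoriality, and the second holds because the form
   nu vanishes on M.  For R in CC and T rational in the residue disk of R - b,
   put D = R - b - T, a point of J(Z_p)_0.

   The translation-invariant forms, obtained by differentiating x' |-> x' - x
   at x' = x, have arbitrary prescribed values at the origin, and for p > 2
   multiplication by p^k acts on coordinates in J(Z_p)_0 like the scalar p^k up
   to higher order.  Hence a point of J(Z_p)_0 is divisible by p^e in
   coordinates as soon as its integrals against these forms are divisible by
   p^e; in particular log is injective on J(Z_p)_0.  So log D in log M_0 gives
   D in M_0, whence R lies in GLC.

   As the integrals of V vanish on D, linear algebra over Q_p shows that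
   p^k log D is a Z_p-combination of elements of log M_0.  Approximating the
   coefficients by natural numbers shows that p^k D is a p-adic limit of
   elements of M_0, hence belongs to the closed subgroup M_0. *)

(** * Evaluation of polynomials *)

(** The integrals are given only through additivity and through an expansion that holds from some
    unspecified depth [K] on. Multiplication by [p^K] pushes a point of the kernel of reduction to
    that depth, so its effect on leading coordinates must be known modulo p. This forces a
    second-order expansion of the group law at the origin: at scale p^k the quadratic term of
    multiplication by p is 'C(p, 2) p^(2k), and for k = 1 it is negligible against p^(k+1) only
    because p divides the binomial coefficient.

    Everything is computed in ambient homogeneous coordinates, normalised at an index [i0] where the
    origin has a unit coordinate. The test forms are therefore indexed by ambient covectors and
    glued from the polynomial formulas for addition and inverse. Nearby points are written x + q v,
    so that one Taylor formula serves q = p^k, where it yields congruences, and q = eps over the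
    dual numbers, where it yields derivatives. *)

Lemma mpoly_alg_ind (R : nzRingType) n (P : {mpoly R[n]} -> Prop) :
  (forall c, P c%:MP) -> (forall i, P 'X_i) ->
  (forall f g, P f -> P g -> P (f + g)) ->
  (forall f g, P f -> P g -> P (f * g)) -> forall f, P f.
Proof.
move=> PC PX PD PM f; have P1 : P 1 by rewrite -mpolyC1.
rewrite (mpolyE f); apply: (big_ind P) => // [|mm _]; first by rewrite -mpolyC0.
rewrite -mul_mpolyC; apply: (PM _ _ (PC _)); rewrite mpolyXE_id.
apply: (big_ind P) => // i _; elim: (mm i) => [|k IH]; rewrite ?expr0 ?exprS //.
exact: PM.
Qed.

Section Evaluation.
Variables (R : nzRingType) (A : comNzRingType) (n : nat).
Implicit Types (phi : {rmorphism R -> A}) (x v : 'rV[A]_n) (f : {mpoly R[n]}).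

Lemma evC phi x c : ev phi x c%:MP = phi c.
Proof. exact: mmapC. Qed.

Lemma evX phi x i : ev phi x 'X_i = x 0 i.
Proof. by rewrite /ev mmapX mmap1U. Qed.

Lemma evD phi x : {morph ev phi x : f g / f + g}.
Proof. exact: mmapD. Qed.

Lemma evM phi x : {morph ev phi x : f g / f * g}.
Proof. by move=> f g; rewrite /ev rmorphM. Qed.

(** Every monomial of f acquires the same factor. Constant weights give the scaling law of
    homogeneous polynomials, weights constant on two blocks that of bihomogeneous ones. *)
Lemma ev_weight phi (w : 'I_n -> A) x C f :
  (forall mm, mm \in msupp f -> \prod_i w i ^+ mm i = C) ->
  ev phi (\row_i (w i * x 0 i)) f = C * ev phi x f.
Proof.
move=> wC; rewrite /ev /mmap mulr_sumr; apply: eq_big_seq => mm /wC <-.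
rewrite /mmap1 mulrCA -big_split /=; congr (_ * _).
by apply: eq_bigr => i _; rewrite mxE exprMn.
Qed.

Lemma ev_homog phi c x d f : f \is d.-homog ->
  ev phi (c *: x) f = c ^+ d * ev phi x f.
Proof.
move/dhomogP => fd; rewrite -(@ev_weight phi (fun=> c)) => [|mm /fd <-].
  by congr ev; apply/rowP=> i; rewrite !mxE.
by rewrite prodrXr -mdegE.
Qed.

(** Induction on the construction of f keeps the remainder a multiple of q^2 in the ring itself,
    without dividing by factorials; hence the formula holds over every commutative ring. *)
Lemma ev_taylor phi x v q f : exists h,
  ev phi (x + q *: v) f =
  ev phi x f + q * (\sum_i ev phi x (mderiv i f) * v 0 i) + q ^+ 2 * h.
Proof.
elim/mpoly_alg_ind: f => [c|i|f g [h Eh] [k Ek]|f g [h Eh] [k Ek]].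
- exists 0; rewrite !evC big1 ?mulr0 ?addr0 // => i _.
  by rewrite mderivC /ev mmap0 mul0r.
- exists 0; rewrite !evX (bigD1 i) //= big1 => [|j neq_ji].
    have Ui0 : (U_(i) - U_(i))%MM = 0%MM :> 'X_{1..n}.
      by apply/mnmP=> j; rewrite mnmBE subnn mnm0E.
    rewrite mderivX mnm1E eqxx scale1r Ui0 mpolyX0 -mpolyC1 evC rmorph1.
    by rewrite !mxE; ring.
  by rewrite mderivX mnm1E eq_sym (negPf neq_ji) scale0r /ev mmap0 mul0r.
- exists (h + k); rewrite !evD Eh Ek.
  under [in RHS]eq_bigr => i _ do rewrite mderivD evD mulrDl.
  by rewrite big_split /=; ring.
set F := \sum_i _ in Eh; set G := \sum_i _ in Ek.
exists (ev phi x f * k + F * G + h * ev phi x g + q * (F * k + h * G) + q^+2 * h * k).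
rewrite !evM Eh Ek.
under [in RHS]eq_bigr => i _ do
  rewrite mderivM evD !evM mulrDl [_ * ev phi x g]mulrC -!mulrA.
by rewrite big_split /= -!mulr_sumr -/F -/G; ring.
Qed.
End Evaluation.

Lemma ev_bihomog (R : nzRingType) (A : comNzRingType) a1 a2 (phi : {rmorphism R -> A})
    c d d1 d2 (x : 'rV[A]_a1) (y : 'rV[A]_a2) (f : {mpoly R[a1 + a2]}) :
  (forall mm, mm \in msupp f ->
    (\sum_(i < a1) mm (lshift a2 i) = d1)%N /\
    (\sum_(i < a2) mm (rshift a1 i) = d2)%N) ->
  ev phi (row_mx (c *: x) (d *: y)) f = c ^+ d1 * d ^+ d2 * ev phi (row_mx x y) f.
Proof.
move=> fd; rewrite -(@ev_weight _ _ _ phi (fun i => if split i is inl _ then c else d))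
  => [|mm /fd [<- <-]].
  congr ev; apply/rowP=> i; rewrite !mxE.
  by case: (splitP i) => j _; rewrite mxE.
rewrite big_split_ord -!prodrXr /=.
by congr (_ * _); apply: eq_bigr => i _; rewrite ?(unsplitK (inl i)) ?(unsplitK (inr i)).
Qed.

Lemma ev_morph (R : nzRingType) (A B : comNzRingType) n (phi : {rmorphism R -> A})
    (psi : {rmorphism R -> B}) (g : {rmorphism A -> B}) (x : 'rV[A]_n) f :
  (forall c, g (phi c) = psi c) -> g (ev phi x f) = ev psi (map_mx g x) f.
Proof.
move=> Eg; rewrite /ev /mmap rmorph_sum; apply: eq_bigr => mm _.
rewrite rmorphM Eg rmorph_prod; congr (_ * _).
by apply: eq_bigr => i _; rewrite rmorphXn mxE.
Qed.

Lemma ev_intr_morph (A B : comNzRingType) n (g : {rmorphism A -> B}) (x : 'rV[A]_n) f :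
  g (ev intr x f) = ev intr (map_mx g x) f.
Proof. by apply: ev_morph => c; rewrite rmorph_int. Qed.

(* T is the mixed second-order term; none of c, l1, l2, T depends on the step q. *)
Lemma ev_mixed_taylor (A : comNzRingType) k (x y : 'rV[A]_k) (f : {mpoly int[k + k]}) :
  exists (c : A) (l1 l2 : 'rV[A]_k -> A) (T : 'rV[A]_k -> 'rV[A]_k -> A),
    (forall q u v w, T (q *: u + v) w = q * T u w + T v w) /\
    (forall q u v, exists e1 e2 e3,
      [/\ ev intr (row_mx (x + q *: u) y) f = c + q * l1 u + q ^+ 2 * e1,
          ev intr (row_mx x (y + q *: v)) f = c + q * l2 v + q ^+ 2 * e2,
          ev intr (row_mx (x + q *: u) (y + q *: v)) f =
            ev intr (row_mx (x + q *: u) y) f + ev intr (row_mx x (y + q *: v)) f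
            - c + q ^+ 2 * T u v + q ^+ 3 * e3,
          ev intr (row_mx x y) f = c &
          l1 (q *: u + v) = q * l1 u + l1 v]).
Proof.
elim/mpoly_alg_ind: f => [c|i|f g|f g].
- exists c%:~R, (fun=> 0), (fun=> 0), (fun _ _ => 0).
  split=> [q u v w|q u v]; first by ring.
  by exists 0, 0, 0; rewrite !evC; split; ring.
- exists (row_mx x y 0 i), (fun u => row_mx u 0 0 i), (fun v => row_mx 0 v 0 i), (fun _ _ => 0).
  split=> [q u v w|q u v]; first by ring.
  exists 0, 0, 0; rewrite !evX !mxE.
  by case: (split i) => j; rewrite !mxE; split; ring.
- move=> [c [l1 [l2 [T [LT HT]]]]] [d [m1 [m2 [S [LS HS]]]]].
  exists (c + d), (fun u => l1 u + m1 u), (fun u => l2 u + m2 u), (fun u v => T u v + S u v).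
  split=> [q u v w|q u v]; first by rewrite LT LS; ring.
  have [e1 [e2 [e3 [E1 E2 E3 E4 E5]]]] := HT q u v.
  have [k1 [k2 [k3 [K1 K2 K3 K4 K5]]]] := HS q u v.
  exists (e1 + k1), (e2 + k2), (e3 + k3).
  by rewrite !evD E3 K3 E1 K1 E2 K2 E4 K4 E5 K5; split; ring.
move=> [c [l1 [l2 [T [LT HT]]]]] [d [m1 [m2 [S [LS HS]]]]].
(* Leibniz rule: besides [d * T] and [c * S], the mixed term of a product pairs the derivative of
   one factor in u with that of the other in v. *)
exists (c * d), (fun u => d * l1 u + c * m1 u), (fun u => d * l2 u + c * m2 u),
  (fun u v => l1 u * m2 v + m1 u * l2 v + d * T u v + c * S u v).
have Ll q u v : l1 (q *: u + v) = q * l1 u + l1 v.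
  by have [? [? [? []]]] := HT q u v.
have Lm q u v : m1 (q *: u + v) = q * m1 u + m1 v.
  by have [? [? [? []]]] := HS q u v.
split=> [q u v w|q u v]; first by rewrite LT LS Ll Lm; ring.
have [e1 [e2 [e3 [E1 E2 E3 E4 E5]]]] := HT q u v.
have [k1 [k2 [k3 [K1 K2 K3 K4 K5]]]] := HS q u v.
(* Increments of the two factors divided by q. The third witness below collects what the mixed
   difference of the product leaves from order q^3 on. *)
pose a1 := l1 u + q * e1; pose a2 := l2 v + q * e2.
pose b1 := m1 u + q * k1; pose b2 := m2 v + q * k2.
exists (l1 u * m1 u + c * k1 + d * e1 + q * (l1 u * k1 + e1 * m1 u) + q ^+ 2 * e1 * k1).
exists (l2 v * m2 v + c * k2 + d * e2 + q * (l2 v * k2 + e2 * m2 v) + q ^+ 2 * e2 * k2).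
exists (l1 u * k2 + e1 * m2 v + q * e1 * k2 + m1 u * e2 + k1 * l2 v + q * k1 * e2
   + (a1 + a2 + q * T u v) * (S u v + q * k3) + c * k3
   + (b1 + b2) * (T u v + q * e3) + d * e3 + e3 * q ^+ 2 * (S u v + q * k3)).
rewrite !evM E3 K3 E1 K1 E2 K2 E4 K4 Ll Lm /a1 /a2 /b1 /b2; split; ring.
Qed.

(** * Points of projective schemes *)

Section Proportional.
Variable (A : comUnitRingType).

(** Equality in projective space. Primitivity is built in because the vanishing of the 2x2 minors
    alone is not transitive: the zero vector satisfies it with every vector. *)
Definition prop_eq n (x y : 'rV[A]_n) : Prop :=
  [/\ primitive x, primitive y & proj_eq x y].

Lemma primitiveZ n c (x : 'rV[A]_n) :
  c \is a GRing.unit -> primitive x -> primitive (c *: x).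
Proof. by move=> Uc /existsP[i Ui]; apply/existsP; exists i; rewrite mxE unitrM Uc. Qed.

Lemma prop_eqP n (x y : 'rV[A]_n) :
  prop_eq x y <-> primitive x /\ exists2 c, c \is a GRing.unit & y = c *: x.
Proof.
split=> [[px py /forallP exy]|[px [c Uc ->]]]; last first.
  split=> //; first exact: primitiveZ.
  by apply/forallP=> i; apply/forallP=> j; rewrite !mxE; apply/eqP; ring.
split=> //; have /existsP[i Ui] := px; have /existsP[j Uj] := py.
have Ey : y = (y 0 i / x 0 i) *: x.
  apply/rowP=> k; rewrite mxE; have /forallP/(_ k)/eqP Ek := exy i.
  by rewrite mulrAC [y 0 i * _]mulrC -Ek mulrAC divrr ?mul1r.
exists (y 0 i / x 0 i) => //.
by move: Uj; rewrite {1}Ey mxE unitrM => /andP[].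
Qed.

Lemma prop_eq_refl n (x : 'rV[A]_n) : primitive x -> prop_eq x x.
Proof. by move=> px; apply/prop_eqP; split=> //; exists 1; rewrite ?unitr1 ?scale1r. Qed.

Lemma prop_eq_sym n (x y : 'rV[A]_n) : prop_eq x y -> prop_eq y x.
Proof.
case=> px py /forallP exy; split=> //; apply/forallP=> i; apply/forallP=> j.
by have /forallP/(_ i)/eqP := exy j; rewrite mulrC => ->; rewrite mulrC.
Qed.

Lemma prop_eq_trans n (x y z : 'rV[A]_n) : prop_eq x y -> prop_eq y z -> prop_eq x z.
Proof.
move=> /prop_eqP[px [c Uc ->]] /prop_eqP[_ [d Ud ->]]; apply/prop_eqP; split=> //.
by exists (d * c); rewrite ?scalerA ?unitrM ?Ud.
Qed.

Lemma prop_eqZ n c (x : 'rV[A]_n) :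
  c \is a GRing.unit -> primitive x -> prop_eq x (c *: x).
Proof. by move=> Uc px; apply/prop_eqP; split=> //; exists c. Qed.

Lemma prop_eq_unit n (x y : 'rV[A]_n) i :
  prop_eq x y -> x 0 i \is a GRing.unit -> y 0 i \is a GRing.unit.
Proof. by move=> /prop_eqP[_ [c Uc ->]]; rewrite mxE unitrM Uc. Qed.

Lemma prop_eqE n (x y : 'rV[A]_n) i j : prop_eq x y -> x 0 i * y 0 j = x 0 j * y 0 i.
Proof. by case=> _ _ /forallP/(_ i)/forallP/(_ j)/eqP. Qed.

Lemma point_prim n X (x : 'rV[A]_n) : point X A x -> primitive x.
Proof. by case. Qed.

Lemma point_prop n X (x y : 'rV[A]_n) :
  (forall f, f \in X -> homogeneous f) ->
  prop_eq x y -> point X A x -> point X A y.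
Proof.
move=> hX /prop_eqP[px [c Uc ->]] [_ zx]; split; first exact: primitiveZ.
by move=> f fX; have [d hd] := hX f fX; rewrite (ev_homog _ _ _ hd) zx ?mulr0.
Qed.

Lemma mor_atZ a b (t : b.-tuple {mpoly int[a]}) c (x : 'rV[A]_a) d :
  (forall j, tnth t j \is d.-homog) -> mor_at t (c *: x) = c ^+ d *: mor_at t x.
Proof. by move=> ht; apply/rowP=> j; rewrite !mxE (ev_homog _ _ _ (ht j)). Qed.

Lemma mor_atZZ a1 a2 b (t : b.-tuple {mpoly int[a1 + a2]}) c d (x : 'rV[A]_a1) y d1 d2 :
  (forall j, bihomog d1 d2 (tnth t j)) ->
  mor_at t (row_mx (c *: x) (d *: y)) = c ^+ d1 * d ^+ d2 *: mor_at t (row_mx x y).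
Proof. by move=> ht; apply/rowP=> j; rewrite !mxE (ev_bihomog _ _ _ _ _ (ht j)). Qed.

Variables (p a b : nat) (dom : forall A : comUnitRingType, 'rV[A]_a -> Prop).
Variables (Y : seq {mpoly int[b]}) (F : morphism a b).
Hypotheses (locA : local_algebra p A) (hF : is_morphism p dom Y F).
Implicit Types (x : 'rV[A]_a) (y z : 'rV[A]_b).

Lemma mor_val_ex x : dom x -> exists y, mor_val F x y.
Proof.
move=> dx; have [[t tF pt] _ _] := hF locA dx; exists (mor_at t x); split=> //.
by exists t; split=> //; have [] := prop_eq_refl pt.
Qed.

Lemma mor_val_prop x y z : mor_val F x y -> prop_eq y z -> mor_val F x z.
Proof.
move=> [py [t [tF pt et]]] yz; have [_ _ e] : prop_eq (mor_at t x) z.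
  by apply: prop_eq_trans yz; split.
by split; [have [] := yz | exists t].
Qed.

Lemma mor_val_mor x t : t \in F -> primitive (mor_at t x) -> mor_val F x (mor_at t x).
Proof. by move=> tF pt; split=> //; exists t; split=> //; case: (prop_eq_refl pt). Qed.

Lemma mor_val_at x y : mor_val F x y -> exists t, t \in F /\ prop_eq (mor_at t x) y.
Proof. by move=> [py [t [tF pt et]]]; exists t; split. Qed.

(** The hypothesis on the tuples says that x' gives the same values as x up to units. It is what
    rescaling does to homogeneous and to bihomogeneous tuples alike, so both kinds of morphisms
    share this argument. *)
Lemma mor_val_uniq x x' y y' : dom x ->
  (forall t, t \in F -> exists2 c, c \is a GRing.unit & mor_at t x' = c *: mor_at t x) ->
  mor_val F x y -> mor_val F x' y' -> prop_eq y y'.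
Proof.
move=> dx ht /mor_val_at[t [tF ty]] /mor_val_at[u [uF uy]].
have [c Uc Eu] := ht u uF.
have pu : primitive (mor_at u x).
  have [pu _ _] := uy; rewrite Eu in pu.
  by have := primitiveZ (c := c^-1) _ pu; rewrite unitrV scalerA mulVr ?scale1r //; apply.
have [_ _ /(_ t u tF uF)] := hF locA dx.
have [pt _ _] := ty => /(_ pt pu) e.
apply: (prop_eq_trans (prop_eq_sym ty)); apply: prop_eq_trans uy.
by rewrite Eu; apply: prop_eq_trans (prop_eqZ _ _) => //; split.
Qed.

Lemma mor_val_transfer x x' y : dom x -> dom x' ->
  (forall t, t \in F -> exists2 c, c \is a GRing.unit & mor_at t x' = c *: mor_at t x) ->
  mor_val F x y -> mor_val F x' y.
Proof.
move=> dx dx' ht xy; have [y' Fx'y'] := mor_val_ex dx'.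
by apply: (mor_val_prop Fx'y'); apply/prop_eq_sym; apply: (mor_val_uniq dx ht xy Fx'y').
Qed.

Lemma mor_val_point x y : (forall f, f \in Y -> homogeneous f) ->
  dom x -> mor_val F x y -> point Y A y.
Proof.
move=> hY dx /mor_val_at[t [tF ty]]; apply: (point_prop _ ty) => //.
by have [_ Pt _] := hF locA dx; apply: Pt => //; case: ty.
Qed.

End Proportional.

Section Projective.
Variables (A : comUnitRingType) (p a b : nat).
Variables (X : seq {mpoly int[a]}) (Y : seq {mpoly int[b]}) (F : morphism a b).
Hypotheses (locA : local_algebra p A) (hF : proj_morphism p X Y F).
Hypothesis (hX : forall f, f \in X -> homogeneous f).

Lemma proj_scaled (x x' : 'rV[A]_a) : prop_eq x x' ->
  forall t, t \in F -> exists2 c, c \is a GRing.unit & mor_at t x' = c *: mor_at t x.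
Proof.
move=> /prop_eqP[_ [c Uc ->]] t tF; have [d hd] := hF.1 t tF.
by exists (c ^+ d); rewrite ?unitrX // (mor_atZ _ _ hd).
Qed.

Lemma proj_val_uniq (x x' : 'rV[A]_a) y y' : point X A x -> prop_eq x x' ->
  mor_val F x y -> mor_val F x' y' -> prop_eq y y'.
Proof. by move=> Px /proj_scaled; apply: mor_val_uniq locA hF.2 _ _ _ _ Px. Qed.

Lemma proj_val_transfer (x x' : 'rV[A]_a) y : point X A x -> prop_eq x x' ->
  mor_val F x y -> mor_val F x' y.
Proof.
move=> Px xx'; apply: (mor_val_transfer locA hF.2) => //; last exact: proj_scaled.
exact: (point_prop _ xx' Px).
Qed.
End Projective.

Section BiProjective.
Variables (A : comUnitRingType) (p a1 a2 b : nat).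
Variables (X1 : seq {mpoly int[a1]}) (X2 : seq {mpoly int[a2]}).
Variables (Y : seq {mpoly int[b]}) (F : morphism (a1 + a2) b).
Hypotheses (locA : local_algebra p A) (hF : biproj_morphism p X1 X2 Y F).
Hypothesis (hX1 : forall f, f \in X1 -> homogeneous f).
Hypothesis (hX2 : forall f, f \in X2 -> homogeneous f).

Lemma biproj_scaled (x x' : 'rV[A]_a1) (y y' : 'rV[A]_a2) : prop_eq x x' -> prop_eq y y' ->
  forall t, t \in F -> exists2 c, c \is a GRing.unit &
    mor_at t (row_mx x' y') = c *: mor_at t (row_mx x y).
Proof.
move=> /prop_eqP[_ [c Uc ->]] /prop_eqP[_ [d Ud ->]] t tF.
have [d1 [d2 hd]] := hF.1 t tF.
by exists (c ^+ d1 * d ^+ d2); rewrite ?unitrM ?unitrX // (mor_atZZ _ _ _ _ hd).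
Qed.

Lemma pair_pointP (x : 'rV[A]_a1) (y : 'rV[A]_a2) :
  point X1 A x -> point X2 A y -> pair_point X1 X2 (row_mx x y).
Proof. by move=> Px Py; rewrite /pair_point row_mxKl row_mxKr. Qed.

Lemma biproj_val_uniq (x x' : 'rV[A]_a1) (y y' : 'rV[A]_a2) z z' :
  point X1 A x -> point X2 A y -> prop_eq x x' -> prop_eq y y' ->
  mor_val F (row_mx x y) z -> mor_val F (row_mx x' y') z' -> prop_eq z z'.
Proof.
move=> Px Py xx' yy'; have := pair_pointP Px Py => P.
exact: mor_val_uniq locA hF.2 _ _ _ _ P (biproj_scaled xx' yy').
Qed.

Lemma biproj_val_transfer (x x' : 'rV[A]_a1) (y y' : 'rV[A]_a2) z :
  point X1 A x -> point X2 A y -> prop_eq x x' -> prop_eq y y' ->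
  mor_val F (row_mx x y) z -> mor_val F (row_mx x' y') z.
Proof.
move=> Px Py xx' yy'; apply: (mor_val_transfer locA hF.2); last exact: biproj_scaled.
  exact: pair_pointP.
by apply: pair_pointP; [apply: (point_prop _ xx' Px) | apply: (point_prop _ yy' Py)].
Qed.
End BiProjective.

Section BaseChange.
Variables (A B : comUnitRingType) (phi : {rmorphism A -> B}).

Lemma map_primitive n (x : 'rV[A]_n) : primitive x -> primitive (map_mx phi x).
Proof. by move=> /existsP[i Ui]; apply/existsP; exists i; rewrite mxE rmorph_unit. Qed.

Lemma map_prop_eq n (x y : 'rV[A]_n) : prop_eq x y -> prop_eq (map_mx phi x) (map_mx phi y).
Proof.
case=> px py /forallP e; split; try exact: map_primitive.
apply/forallP=> i; apply/forallP=> j; rewrite !mxE -!rmorphM.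
by have /forallP/(_ j)/eqP-> := e i.
Qed.

Lemma map_point n X (x : 'rV[A]_n) : point X A x -> point X B (map_mx phi x).
Proof.
case=> px zx; split; first exact: map_primitive.
by move=> f /zx; rewrite -ev_intr_morph => ->; rewrite rmorph0.
Qed.

Lemma map_mor_at a b (t : b.-tuple {mpoly int[a]}) (x : 'rV[A]_a) :
  map_mx phi (mor_at t x) = mor_at t (map_mx phi x).
Proof. by apply/rowP=> j; rewrite !mxE ev_intr_morph. Qed.

Lemma map_mor_val a b (F : morphism a b) (x : 'rV[A]_a) y :
  mor_val F x y -> mor_val F (map_mx phi x) (map_mx phi y).
Proof.
case=> py [t [tF pt et]]; have [p1 p2 e] : prop_eq (map_mx phi (mor_at t x)) (map_mx phi y).
  by apply: map_prop_eq; split.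
by split=> //; exists t; rewrite -map_mor_at.
Qed.

Lemma map_intmx n (z : 'rV[int]_n) : map_mx phi (intmx A z) = intmx B z.
Proof. by apply/rowP=> j; rewrite !mxE rmorph_int. Qed.
End BaseChange.

(** * The group of points *)

Lemma unit_intr (p : nat) (A : comUnitRingType) (z : int) :
  prime p -> local_algebra p A -> ~~ (p%:Z %| z)%Z -> z%:~R \is a @GRing.unit A.
Proof.
move=> pp [_ hq] pz; have : `|z|%:R \is a @GRing.unit A.
  by apply: hq; rewrite coprime_sym prime_coprime.
rewrite {2}[z]intEsign rmorphM /= rmorph_sign unitrM unitrX ?unitrN1 //.
Qed.

Lemma zpoint_point (p n : nat) X (z : 'rV[int]_n) (A : comUnitRingType) :
  prime p -> local_algebra p A -> zpoint p X z -> point X A (intmx A z).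
Proof.
move=> pp locA [[i zi] zX]; split=> [|f /zX Ef].
  by apply/existsP; exists i; rewrite mxE (unit_intr pp).
by rewrite -ev_intr_morph Ef rmorph0.
Qed.

Section Group.
Variables (p g m : nat) (J : group_data m) (A : comUnitRingType).
Hypotheses (hJ : abelian_scheme p g J) (pp : prime p) (locA : local_algebra p A).
Implicit Types x y z u v w : 'rV[A]_m.+1.
Local Notation pt := (point (geqs J) A).
Local Notation one := (intmx A (gone J)).

Lemma geqs_homog f : f \in geqs J -> homogeneous f.
Proof. by case: hJ => [[[_ + _] _] _ _ _ _]; apply. Qed.

Lemma gadd_mor : biproj_morphism p (geqs J) (geqs J) (geqs J) (gadd J).
Proof. by case: hJ. Qed.

Lemma gopp_mor : proj_morphism p (geqs J) (geqs J) (gopp J).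
Proof. by case: hJ. Qed.

Lemma gone_point : pt one.
Proof. by apply: (zpoint_point pp locA); case: hJ. Qed.

Lemma gpoint_prop x y : prop_eq x y -> pt x -> pt y.
Proof. by apply: point_prop => f; apply: geqs_homog. Qed.

Lemma add_point x y z : pt x -> pt y -> add_rel J x y z -> pt z.
Proof.
move=> Px Py; apply: (mor_val_point locA gadd_mor.2) => [f|]; first exact: geqs_homog.
exact: pair_pointP.
Qed.

Lemma add_ex x y : pt x -> pt y -> exists z, add_rel J x y z.
Proof. by move=> Px Py; apply: (mor_val_ex locA gadd_mor.2); apply: pair_pointP. Qed.

Lemma add_uniq x x' y y' z z' : pt x -> pt y -> prop_eq x x' -> prop_eq y y' ->
  add_rel J x y z -> add_rel J x' y' z' -> prop_eq z z'.
Proof. exact: (biproj_val_uniq locA gadd_mor). Qed.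

Lemma add_transfer x x' y y' z z' : pt x -> pt y ->
  prop_eq x x' -> prop_eq y y' -> prop_eq z z' ->
  add_rel J x y z -> add_rel J x' y' z'.
Proof.
move=> Px Py xx' yy' zz' xyz; apply: (mor_val_prop _ zz').
by apply: (biproj_val_transfer locA gadd_mor _ _ Px Py xx' yy' xyz) => f; apply: geqs_homog.
Qed.

Lemma add_one x : pt x -> add_rel J one x x.
Proof. by case: hJ => _ _ _ _ /(_ A locA)[+ _ _ _] => /(_ x). Qed.

Lemma opp_ex x : pt x -> exists2 y, mor_val (gopp J) x y & pt y.
Proof.
move=> Px; have [y xy] := mor_val_ex locA gopp_mor.2 Px; exists y => //.
by apply: (mor_val_point locA gopp_mor.2 _ Px xy) => f; apply: geqs_homog.
Qed.

Lemma add_opp x y : pt x -> mor_val (gopp J) x y -> add_rel J y x one.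
Proof. by case: hJ => _ _ _ _ /(_ A locA)[_ + _ _] => /(_ x y). Qed.

Lemma add_comm x y z : pt x -> pt y -> add_rel J x y z -> add_rel J y x z.
Proof. by case: hJ => _ _ _ _ /(_ A locA)[_ _ + _] => /(_ x y z). Qed.

Lemma add_assoc x y z u v w : pt x -> pt y -> pt z -> add_rel J x y u ->
  add_rel J u z w -> add_rel J y z v -> add_rel J x v w.
Proof. by case: hJ => _ _ _ _ /(_ A locA)[_ _ _ +]; apply. Qed.

Definition prop_eqb x y := [&& primitive x, primitive y & proj_eq x y].

Lemma prop_eqbP x y : reflect (prop_eq x y) (prop_eqb x y).
Proof. by apply: (iffP and3P). Qed.

(** [choose] depends only on the extension of its predicate, so proportional primitive vectors
    obtain the same representative. *)
Definition canon x := choose (prop_eqb x) x.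

Lemma canon_prop x : primitive x -> prop_eq x (canon x).
Proof. by move/prop_eq_refl/prop_eqbP => xx; apply/prop_eqbP; apply: chooseP xx. Qed.

Lemma canon_eq x y : prop_eq x y -> canon x = canon y.
Proof.
move=> xy; have e : prop_eqb x =1 prop_eqb y.
  move=> z; apply/prop_eqbP/prop_eqbP; apply: prop_eq_trans => //.
  exact: prop_eq_sym.
rewrite /canon (eq_choose e); apply: choose_id; last by apply/prop_eqbP/prop_eq_refl; case: xy.
by apply/prop_eqbP; apply: prop_eq_sym.
Qed.

Definition pointb x := primitive x && all (fun f => ev intr x f == 0) (geqs J).

Lemma pointbP x : reflect (pt x) (pointb x).
Proof.
apply: (iffP andP) => [[px /allP zx]|[px zx]]; split=> //.
  by move=> f /zx/eqP.
by apply/allP=> f /zx->.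
Qed.

Definition add_relb x y z := primitive z &&
  has (fun t => primitive (mor_at t (row_mx x y)) && proj_eq (mor_at t (row_mx x y)) z) (gadd J).

Lemma add_relbP x y z : reflect (add_rel J x y z) (add_relb x y z).
Proof.
apply: (iffP andP) => [[pz /hasP[t tF /andP[pt et]]]|[pz [t [tF pt et]]]]; split=> //.
  by exists t.
by apply/hasP; exists t => //; rewrite pt.
Qed.

(** The carrier is the subtype of canonical coordinate vectors. The relations have boolean versions,
    so sums and inverses can be extracted by [xchoose], and the relational group law turns into a
    [zmodType] in which one can rewrite. *)
Lemma point_group : exists (G : zmodType) (rep : G -> 'rV[A]_m.+1),
  [/\ forall a, pt (rep a), forall x, pt x -> exists a, prop_eq (rep a) x,
      forall a b, prop_eq (rep a) (rep b) -> a = b,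
      forall a b, add_rel J (rep a) (rep b) (rep (a + b)) & prop_eq (rep 0) one].
Proof.
pose T := {x : 'rV[A]_m.+1 | pointb x && (canon x == x)}.
have mkT x : pt x -> exists a : T, prop_eq (val a) x.
  move=> Px; have xc := canon_prop (point_prim Px).
  have Tx : pointb (canon x) && (canon (canon x) == canon x).
    by rewrite -(canon_eq xc) eqxx andbT; apply/pointbP/(gpoint_prop xc).
  by exists (Sub (canon x) Tx); rewrite SubK; apply: prop_eq_sym.
have TP (a : T) : pt (val a) by apply/pointbP; have /andP[] := valP a.
have Tinj (a b : T) : prop_eq (val a) (val b) -> a = b.
  move/canon_eq=> e; apply: val_inj.
  by have /andP[_ /eqP<-] := valP a; have /andP[_ /eqP<-] := valP b.
have Trefl (a : T) : prop_eq (val a) (val a) by apply: prop_eq_refl; case: (TP a).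
have addT (a b : T) : exists c : T, add_relb (val a) (val b) (val c).
  have [z xyz] := add_ex (TP a) (TP b); have [c cz] := mkT z (add_point (TP a) (TP b) xyz).
  exists c; apply/add_relbP.
  by apply: (add_transfer (TP a) (TP b) _ _ _ xyz) => //; apply: prop_eq_sym.
pose add a b := xchoose (addT a b).
have addP a b : add_rel J (val a) (val b) (val (add a b)).
  by apply/add_relbP; exact: (xchooseP (addT a b)).
have addE (a b c : T) : add_rel J (val a) (val b) (val c) -> add a b = c.
  by move=> abc; apply: Tinj; apply: (add_uniq (TP a) (TP b) _ _ (addP a b) abc).
have oppT (a : T) : exists b : T, add_relb (val b) (val a) one.
  have [y xy Py] := opp_ex (TP a); have [b by_] := mkT y Py.
  exists b; apply/add_relbP; apply: add_transfer (add_opp (TP a) xy) => //.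
    exact: prop_eq_sym.
  by apply: prop_eq_refl; case: gone_point.
have oneT : exists a : T, prop_eqb (val a) one.
  by have [a /prop_eqbP e] := mkT _ gone_point; exists a.
pose zeroT := xchoose oneT; have zeroP : prop_eq (val zeroT) one.
  by apply/prop_eqbP; exact: (xchooseP oneT).
pose opp a := xchoose (oppT a).
have addA : associative add.
  move=> a b c; apply: addE; exact: add_assoc (TP a) (TP b) (TP c) (addP a b) (addP _ c) (addP b c).
have addC : commutative add by move=> a b; apply: addE; apply: add_comm => //; apply: addP.
have add0 : left_id zeroT add.
  move=> a; apply: addE; apply: add_transfer (add_one (TP a)) => //; first exact: gone_point.
  exact: prop_eq_sym.
have addN : left_inverse zeroT opp add.
  move=> a; apply: addE; have /add_relbP := xchooseP (oppT a).
  by apply: add_transfer => //; apply: prop_eq_sym.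
pose G : zmodType := HB.pack T (GRing.isZmodule.Build T addA addC add0 addN).
by exists G, (val : T -> _); split.
Qed.
End Group.

(** * Dual numbers *)

(** The ring A[eps]/(eps^2), as an alias that keeps its product apart from the componentwise one on
    pairs. Tangent vectors are points over it, so identities between morphisms can be differentiated
    by applying them to such points. *)
Definition dual (A : Type) : Type := A * A.

Section Dual.
Variable A : comUnitRingType.
Implicit Types x y z : dual A.

HB.instance Definition _ := GRing.Zmodule.copy (dual A) (A * A)%type.

Definition dual_one : dual A := (1, 0).
Definition dual_mul x y : dual A := (x.1 * y.1, x.1 * y.2 + x.2 * y.1).

Fact dual_mulA : associative dual_mul.
Proof. by move=> x y z; congr (_, _); rewrite /=; ring. Qed.
Fact dual_mulC : commutative dual_mul.
Proof. by move=> x y; congr (_, _); rewrite /=; ring. Qed.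
Fact dual_mul1 : left_id dual_one dual_mul.
Proof. by case=> a b; congr (_, _); rewrite /=; ring. Qed.
Fact dual_mulDl : left_distributive dual_mul +%R.
Proof. by move=> x y z; congr (_, _); rewrite /=; ring. Qed.
Fact dual_neq0 : dual_one != 0.
Proof. by rewrite xpair_eqE negb_and oner_neq0. Qed.

HB.instance Definition _ := GRing.Zmodule_isComNzRing.Build (dual A)
  dual_mulA dual_mulC dual_mul1 dual_mulDl dual_neq0.

Definition dual_unit : pred (dual A) := fun x => x.1 \is a GRing.unit.
Definition dual_inv x : dual A :=
  if dual_unit x then (x.1^-1, - (x.1^-1 ^+ 2 * x.2)) else x.

Fact dual_mulV : {in dual_unit, left_inverse 1 dual_inv *%R}.
Proof.
move=> [a b]; rewrite unfold_in /dual_inv /dual_unit /= => Ua; rewrite Ua.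
congr (_, _); rewrite /= ?mulVr // expr2 mulNr -!mulrA [b * a]mulrC (mulrA _ a).
by rewrite mulVr // mul1r subrr.
Qed.
Fact dual_unitP x y : y * x = 1 -> dual_unit x.
Proof. by case=> e _; apply/unitrP; exists y.1; rewrite e mulrC. Qed.
Fact dual_inv_out : {in [predC dual_unit], dual_inv =1 id}.
Proof. by move=> x Ux; rewrite /dual_inv (negPf (Ux : ~~ dual_unit x)). Qed.

HB.instance Definition _ := GRing.ComNzRing_hasMulInverse.Build (dual A)
  dual_mulV dual_unitP dual_inv_out.

Definition dual_const (a : A) : dual A := (a, 0).
Fact dual_const_additive : additive dual_const.
Proof. by move=> a b; congr (_, _); rewrite /= subrr. Qed.
Fact dual_const_multiplicative : multiplicative dual_const.
Proof. by split=> [a b|//]; congr (_, _); rewrite /=; ring. Qed.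
HB.instance Definition _ := GRing.isAdditive.Build A (dual A) dual_const dual_const_additive.
HB.instance Definition _ :=
  GRing.isMultiplicative.Build A (dual A) dual_const dual_const_multiplicative.

Lemma dual_unitE (x : dual A) : (x \is a GRing.unit) = (x.1 \is a GRing.unit).
Proof. by []. Qed.

Lemma dual_local p : local_algebra p A -> local_algebra p (dual A).
Proof.
move=> [hl hq]; split=> [x y|q /hq].
  by rewrite !dual_unitE; apply: hl.
by rewrite -(rmorph_nat dual_const) dual_unitE.
Qed.
End Dual.

(** * Invariant differential forms *)

Lemma dhomog_prodX (R : comNzRingType) n N (F : 'I_N -> {mpoly R[n]}) (e : 'I_N -> nat)
    (k : 'I_N -> nat) :
  (forall i, F i \is (e i).-homog) -> \prod_i F i ^+ k i \is (\sum_i e i * k i)%N.-homog.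
Proof.
move=> hF; elim/big_rec2: _ => [|i d q _ hq]; first exact: dhomog1.
by apply: dhomogM => //; apply: dhomogMn.
Qed.

Lemma bihomog_mderiv a1 a2 d1 d2 (f : {mpoly int[a1 + a2]}) k :
  bihomog d1 d2 f -> mderiv (lshift a2 k) f != 0 ->
  (0 < d1)%N /\ bihomog d1.-1 d2 (mderiv (lshift a2 k) f).
Proof.
move=> hf nz; suff key mm : mm \in msupp (mderiv (lshift a2 k) f) ->
    (\sum_(i < a1) mm (lshift a2 i)).+1 = d1 /\ \sum_(i < a2) mm (rshift a1 i) = d2.
  split=> [|mm /key[<- <-] //].
  by have /key[<-] := mlead_supp nz.
rewrite mcoeff_msupp mcoeff_mderiv => nz'.
have /hf[<- <-] : (mm + U_(lshift a2 k))%MM \in msupp f.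
  by rewrite mcoeff_msupp; apply: contraNneq nz' => ->; rewrite mul0rn.
split; last by apply: eq_bigr => i _; rewrite mnmDE mnm1E eq_lrshift addn0.
under [RHS]eq_bigr => i _ do rewrite mnmDE mnm1E (inj_eq (@lshift_inj _ _)).
rewrite big_split /=; suff -> : (\sum_(i < a1) (k == i) = 1)%N by rewrite addn1.
by rewrite (bigD1 k) //= eqxx big1 // => i /negPf; rewrite eq_sym => ->.
Qed.

Section InvariantForm.
Variables (p g m : nat) (J : group_data m) (B : comNzRingType).
Hypotheses (hJ : abelian_scheme p g J) (pp : prime p).
Local Notation add_tuple := (m.+1.-tuple {mpoly int[m.+1 + m.+1]}).
Local Notation opp_tuple := (m.+1.-tuple {mpoly int[m.+1]}).
Implicit Types (t : add_tuple) (u : opp_tuple).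

(** The generic point X of the ambient space together with the formula u for -X; polynomials in two
    points become polynomials in X on the antidiagonal. *)
Definition generic_pair u : 'rV[{mpoly B[m.+1]}]_(m.+1 + m.+1) :=
  row_mx (\row_i 'X_i) (\row_j ev intr (\row_i 'X_i) (tnth u j)).

Definition gsum t u j := ev intr (generic_pair u) (tnth t j).

Definition gdiff t u j k := ev intr (generic_pair u) (mderiv (lshift m.+1 k) (tnth t j)).

(* Multiplying numerator and denominator by this factor makes the denominator a
   unit only where u represents the inverse. *)
Definition chart_factor u (ik : 'I_m.+1 * 'I_m.+1) : {mpoly B[m.+1]} :=
  'X_ik.1 * ev intr (\row_i 'X_i) (tnth u ik.2).

(* The pull-back of sum_j a_j d(X_j / X_i0) at the neutral element under
   x' |-> x' - x, at the point x' = x. *)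
Definition inv_chart (i0 : 'I_m.+1) (a : 'rV[B]_m.+1) t u ik : chart B m.+1 :=
  (chart_factor u ik * gsum t u i0 ^+ 2,
   [tuple chart_factor u ik * \sum_j (a 0 j)%:MP *
     (gdiff t u j k * gsum t u i0 - gsum t u j * gdiff t u i0 k) | k < m.+1]).

Definition inv_charts i0 a : seq (chart B m.+1) :=
  [seq inv_chart i0 a tu.1 tu.2 ik |
    tu <- [seq (t, u) | t <- gadd J, u <- gopp J], ik <- enum {: 'I_m.+1 * 'I_m.+1}].

Lemma inv_chartsP i0 a c : c \in inv_charts i0 a <->
  exists t u ik, [/\ t \in gadd J, u \in gopp J & c = inv_chart i0 a t u ik].
Proof.
split=> [/allpairsP[[tu ik] /= [/allpairsP[[t u] /= [tF uF ->]] _ ->]]|[t [u [ik [tF uF ->]]]]].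
  by exists t, u, ik.
apply/allpairsP; exists ((t, u), ik); split; rewrite ?mem_enum //.
by apply/allpairsP; exists (t, u).
Qed.

Lemma generic_opp_homog u e j : (forall j, tnth u j \is e.-homog) ->
  ev intr (\row_i ('X_i : {mpoly B[m.+1]})) (tnth u j) \is e.-homog.
Proof.
move=> hu; rewrite /ev /mmap big_seq; apply: rpred_sum => mm /(dhomog_mf (hu j)) <-.
rewrite mulrzl; apply: rpredMz.
have -> : mmap1 (fun i => (\row_i ('X_i : {mpoly B[m.+1]})) 0 i) mm = 'X_[mm].
  by rewrite -mmap1_id; apply: mmap1_eq => i; rewrite mxE.
by rewrite dhomogX.
Qed.

Lemma generic_homog u e d1 d2 (f : {mpoly int[m.+1 + m.+1]}) :
  (forall j, tnth u j \is e.-homog) -> bihomog d1 d2 f ->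
  ev intr (generic_pair u) f \is (d1 + e * d2)%N.-homog.
Proof.
move=> hu hf; have hX i : ('X_i : {mpoly B[m.+1]}) \is 1.-homog.
  by rewrite dhomogX /= mdeg1.
have hU j := generic_opp_homog j hu.
rewrite /ev /mmap big_seq; apply: rpred_sum => mm /hf[<- <-].
rewrite mulrzl; apply: rpredMz; rewrite /mmap1 big_split_ord /=; apply: dhomogM.
  under eq_bigr => i _ do rewrite row_mxEl mxE.
  have := dhomog_prodX (fun i => mm (lshift m.+1 i)) hX.
  by rewrite -big_distrr /= mul1n.
under eq_bigr => i _ do rewrite row_mxEr mxE.
by have := dhomog_prodX (fun i => mm (rshift m.+1 i)) hU; rewrite -big_distrr.
Qed.

Lemma inv_chart_homog i0 a t u ik : t \in gadd J -> u \in gopp J ->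
  exists d, (inv_chart i0 a t u ik).1 \is d.+1.-homog /\
    forall k, tnth (inv_chart i0 a t u ik).2 k \is d.-homog.
Proof.
move=> /(gadd_mor hJ).1[d1 [d2 ht]] /(gopp_mor hJ).1[e hu].
pose D := (d1 + e * d2)%N; have hs j : gsum t u j \is D.-homog by exact: generic_homog hu (ht j).
have hX : chart_factor u ik \is e.+1.-homog.
  rewrite -[e.+1]add1n; apply: dhomogM (generic_opp_homog _ hu).
  by rewrite dhomogX /= mdeg1.
(* The factor has degree e + 1 and each [gsum] degree D, which gives e + 1 + 2D for the denominator;
   the single derivative in each numerator lowers this by one. *)
exists (e + (D + D))%N; split=> [|k].
  by rewrite /= -addSn; apply: dhomogM => //; rewrite expr2; apply: dhomogM.
have hd j j' : chart_factor u ik * (gdiff t u j k * gsum t u j') \is (e + (D + D))%N.-homog.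
  (* If d1 = 0 the derivative in the first block vanishes and [d1.-1] would miscount; zero is
     homogeneous of every degree. *)
  have [->|nz] := eqVneq (gdiff t u j k) 0; first by rewrite mul0r mulr0 dhomog0.
  have nz' : mderiv (lshift m.+1 k) (tnth t j) != 0.
    by apply: contraNneq nz => e0; rewrite /gdiff e0 /ev mmap0.
  have [d1_gt0 hdf] := bihomog_mderiv (ht j) nz'.
  have -> : (e + (D + D) = e.+1 + ((d1.-1 + e * d2) + D))%N.
    by rewrite [RHS]addSnnS {1}/D -{1}(prednK d1_gt0).
  by apply: dhomogM => //; apply: dhomogM => //; exact: generic_homog hu hdf.
rewrite /= tnth_mktuple mulr_sumr; apply: rpred_sum => j _.
rewrite mulrCA mul_mpolyC; apply: dhomogZ.
by rewrite mulrBr [gsum t u j * _]mulrC rpredB.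
Qed.

Section Values.
Variables (A : comUnitRingType) (phi : {rmorphism B -> A}).
Hypothesis locA : local_algebra p A.
Implicit Types x y v : 'rV[A]_m.+1.

Definition ddir t x y v j :=
  \sum_k ev intr (row_mx x y) (mderiv (lshift m.+1 k) (tnth t j)) * v 0 k.

Lemma map_generic x : map_mx (mmap phi (fun i => x 0 i)) (\row_i 'X_i) = x.
Proof. by apply/rowP=> k; rewrite !mxE mmapX mmap1U. Qed.

Lemma ev_generic u x f :
  ev phi x (ev intr (generic_pair u) f) = ev intr (row_mx x (mor_at u x)) f.
Proof.
rewrite /(ev phi) (ev_intr_morph (mmap phi (fun i => x 0 i))); congr ev.
rewrite /generic_pair map_row_mx map_generic; congr row_mx.
by apply/rowP=> k; rewrite !mxE ev_intr_morph map_generic.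
Qed.

Lemma inv_chart_den i0 a t u ik x : ev phi x (inv_chart i0 a t u ik).1 =
  x 0 ik.1 * mor_at u x 0 ik.2 * mor_at t (row_mx x (mor_at u x)) 0 i0 ^+ 2.
Proof.
rewrite /= evM [_ ^+ 2]expr2 !evM -expr2 ev_generic evX !mxE; congr (_ * _ * _).
by rewrite /(ev phi) (ev_intr_morph (mmap phi (fun i => x 0 i))) map_generic.
Qed.

(** The auxiliary factor cancels, and what remains is the quotient rule for s_j / s_i0,
    differentiated in the first summand only. *)
Lemma inv_chart_val i0 a t u ik x v (y := mor_at u x) (s := mor_at t (row_mx x y)) :
  ev phi x (inv_chart i0 a t u ik).1 \is a GRing.unit ->
  chart_val phi (inv_chart i0 a t u ik) x v =
  \sum_j phi (a 0 j) * ((ddir t x y v j * s 0 i0 - s 0 j * ddir t x y v i0) / s 0 i0 ^+ 2).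
Proof.
move=> U; rewrite /chart_val; apply: (mulIr U); rewrite divrK //.
have evsq q : ev phi x (q ^+ 2) = ev phi x q ^+ 2 by rewrite !expr2 evM.
have [Ux Us] : ev phi x (chart_factor u ik) \is a GRing.unit /\ s 0 i0 \is a GRing.unit.
  move: U; rewrite /= evM unitrM => /andP[-> ].
  by rewrite evsq unitrX_pos // ev_generic -/y /s mxE.
have -> : ev phi x (inv_chart i0 a t u ik).1 = ev phi x (chart_factor u ik) * s 0 i0 ^+ 2.
  by rewrite /= evM evsq ev_generic /s mxE.
rewrite mulr_suml.
under eq_bigr => k _ do
  rewrite tnth_mktuple evM /(ev phi x (\sum_j _)) rmorph_sum /= mulrAC mulr_sumr.
rewrite exchange_big /=; apply: eq_bigr => j _; move: (ev phi x _) => M.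
transitivity (M * (phi (a 0 j) * (ddir t x y v j * s 0 i0 - s 0 j * ddir t x y v i0))); last first.
  move: (ddir _ _ _ _ _ * _ - _) => e; rewrite -{1}[e](divrK (unitrX 2 Us)).
  by move: (e / _) => e'; ring.
rewrite /ddir mulr_suml mulr_sumr -sumrB !mulr_sumr; apply: eq_bigr => k _.
have EG f : mmap phi [eta x 0] (ev intr (generic_pair u) f) = ev intr (row_mx x y) f.
  exact: ev_generic.
rewrite rmorphM rmorphB !rmorphM /= mmapC /gdiff /gsum !EG /s !mxE; ring.
Qed.
End Values.
End InvariantForm.

Lemma mor_taylor_l m (A : comUnitRingType) (t : m.+1.-tuple {mpoly int[m.+1 + m.+1]})
    (x y v : 'rV[A]_m.+1) q j : exists h,
  mor_at t (row_mx (x + q *: v) y) 0 j =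
  mor_at t (row_mx x y) 0 j + q * ddir t x y v j + q ^+ 2 * h.
Proof.
have -> : row_mx (x + q *: v) y = row_mx x y + q *: row_mx v 0.
  by rewrite scale_row_mx scaler0 add_row_mx addr0.
have [h Eh] := ev_taylor intr (row_mx x y) (row_mx v 0) q (tnth t j); exists h.
rewrite !mxE Eh; congr (_ + _ * _ + _); rewrite big_split_ord /=.
rewrite [X in _ + X]big1 ?addr0 => [|i _]; last by rewrite row_mxEr mxE mulr0.
by apply: eq_bigr => i _; rewrite row_mxEl.
Qed.

Section DualPoints.
Variables (p : nat) (A : comUnitRingType).
Definition dual_eps : dual A := (0, 1).
Definition dual_shift n (x v : 'rV[A]_n) : 'rV[dual A]_n :=
  map_mx (@dual_const A) x + dual_eps *: map_mx (@dual_const A) v.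

Lemma dual_eps2 : dual_eps ^+ 2 = 0.
Proof. by rewrite expr2; congr (_, _); rewrite /=; ring. Qed.

Lemma dual_epsE (a b : A) : dual_const a + dual_eps * dual_const b = (a, b).
Proof. by congr (_, _); rewrite /=; ring. Qed.

Lemma dual_shift_prim n (x v : 'rV[A]_n) : primitive x -> primitive (dual_shift x v).
Proof. by move=> /existsP[i Ui]; apply/existsP; exists i; rewrite !mxE dual_epsE. Qed.

Lemma dual_shift_point n X (x v : 'rV[A]_n) :
  point X A x -> tangent X x v -> point X (dual A) (dual_shift x v).
Proof.
move=> [px zx] tv; split=> [|f fX]; first exact: dual_shift_prim.
have [h ->] := ev_taylor intr (map_mx (@dual_const A) x) (map_mx (@dual_const A) v) dual_eps f.
rewrite dual_eps2 mul0r addr0 -ev_intr_morph zx // rmorph0 add0r.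
under eq_bigr => i _ do rewrite mxE -ev_intr_morph -rmorphM.
by rewrite -rmorph_sum /= tv ?rmorph0 ?mulr0.
Qed.

Lemma dual_mor m (t : m.+1.-tuple {mpoly int[m.+1 + m.+1]}) (x y v : 'rV[A]_m.+1) j :
  mor_at t (row_mx (dual_shift x v) (map_mx (@dual_const A) y)) 0 j =
  (mor_at t (row_mx x y) 0 j, ddir t x y v j).
Proof.
have [h ->] := mor_taylor_l t (map_mx (@dual_const A) x) (map_mx (@dual_const A) y)
  (map_mx (@dual_const A) v) dual_eps j.
rewrite dual_eps2 mul0r addr0 -dual_epsE -map_row_mx -map_mor_at mxE; congr (_ + _ * _).
rewrite /ddir rmorph_sum; apply: eq_bigr => i _.
by rewrite mxE -map_row_mx -ev_intr_morph -rmorphM.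
Qed.
End DualPoints.

Section InvariantFormP.
Variables (p g m : nat) (J : group_data m) (B : comNzRingType).
Hypotheses (hJ : abelian_scheme p g J) (pp : prime p).
Variable (i0 : 'I_m.+1).
Hypothesis (hi0 : ~~ (p%:Z %| gone J ord0 i0)%Z).

Section OverA.
Variables (A : comUnitRingType).
Hypothesis locA : local_algebra p A.
Implicit Types x y v : 'rV[A]_m.+1.

Lemma gone_unit : intmx A (gone J) 0 i0 \is a GRing.unit.
Proof. by rewrite mxE (unit_intr pp locA). Qed.

Lemma opp_at u x : point (geqs J) A x -> u \in gopp J -> primitive (mor_at u x) ->
  point (geqs J) A (mor_at u x) /\ add_rel J x (mor_at u x) (intmx A (gone J)).
Proof.
move=> Px uF pu; have xy := mor_val_mor uF pu.
have Py : point (geqs J) A (mor_at u x).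
  by apply: (mor_val_point locA (gopp_mor hJ).2 _ Px xy) => f; apply: geqs_homog hJ _.
by split=> //; apply: (add_comm hJ locA) => //; apply: (add_opp hJ locA).
Qed.

(* The quotient s_j / s_i0 lives over the dual numbers; this is the
   well-definedness of its derivative along v. *)
Lemma ddir_indep t t' x y y' v :
  t \in gadd J -> t' \in gadd J -> point (geqs J) A x -> point (geqs J) A y ->
  prop_eq y y' -> tangent (geqs J) x v ->
  let s := mor_at t (row_mx x y) in let s' := mor_at t' (row_mx x y') in
  s 0 i0 \is a GRing.unit -> s' 0 i0 \is a GRing.unit -> forall j,
  (ddir t x y v j * s 0 i0 - s 0 j * ddir t x y v i0) / s 0 i0 ^+ 2 =
  (ddir t' x y' v j * s' 0 i0 - s' 0 j * ddir t' x y' v i0) / s' 0 i0 ^+ 2.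
Proof.
move=> tF tF' Px Py yy' tv s s' Us Us' j; have locD := dual_local locA.
have PX := dual_shift_point Px tv; have PY := map_point (@dual_const A) Py.
pose Y := map_mx (@dual_const A) y; pose Y' := map_mx (@dual_const A) y'.
have YY' : prop_eq Y Y' by apply: map_prop_eq.
have T1 : add_rel J (dual_shift x v) Y (mor_at t (row_mx (dual_shift x v) Y)).
  apply: (mor_val_mor tF); apply/existsP; exists i0.
  by rewrite dual_mor dual_unitE.
have T2 : add_rel J (dual_shift x v) Y' (mor_at t' (row_mx (dual_shift x v) Y')).
  apply: (mor_val_mor tF'); apply/existsP; exists i0.
  by rewrite dual_mor dual_unitE.
have XX := prop_eq_refl (point_prim PX).
have e := prop_eqE j i0 (add_uniq hJ locD PX PY XX YY' T1 T2).
have {e} e := etrans (esym (f_equal2 *%R (dual_mor t x y v j) (dual_mor t' x y' v i0)))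
  (etrans e (f_equal2 *%R (dual_mor t x y v i0) (dual_mor t' x y' v j))).
have e1 : s 0 j * s' 0 i0 = s 0 i0 * s' 0 j := congr1 fst e.
have e2 : s 0 j * ddir t' x y' v i0 + ddir t x y v j * s' 0 i0 =
  s 0 i0 * ddir t' x y' v j + ddir t x y v i0 * s' 0 j := congr1 snd e.
apply: (mulIr (unitrX 2 Us)); apply: (mulIr (unitrX 2 Us')).
rewrite divrK ?unitrX // [RHS]mulrAC divrK ?unitrX //.
move: (ddir t x y v) (ddir t' x y' v) e2 => D D' e2.
have -> : (D j * s 0 i0 - s 0 j * D i0) * s' 0 i0 ^+ 2 =
   s 0 i0 * s' 0 i0 * (s 0 j * D' i0 + D j * s' 0 i0)
   - s 0 i0 * s' 0 i0 * (s 0 j * D' i0) - (s 0 j * s' 0 i0) * s' 0 i0 * D i0 by ring.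
have -> : s 0 j * s' 0 i0 = s' 0 j * s 0 i0 by rewrite e1 mulrC.
rewrite e2.
have -> : s 0 i0 * s' 0 i0 * (s 0 j * D' i0) = s 0 i0 * (s 0 j * s' 0 i0) * D' i0 by ring.
rewrite e1; ring.
Qed.

(** Euler's relation: moving x along itself is rescaling by 1 + eps, which multiplies all
    coordinates of the sum by one common factor and leaves their quotients fixed. This makes the
    form descend from the cone. *)
Lemma ddir_self t x y : t \in gadd J -> forall j,
  let s := mor_at t (row_mx x y) in ddir t x y x j * s 0 i0 - s 0 j * ddir t x y x i0 = 0.
Proof.
move=> tF j s; have [d1 [d2 hd]] := (gadd_mor hJ).1 t tF.
pose Y := map_mx (@dual_const A) y; pose Z := map_mx (@dual_const A) x.
have Eshift : dual_shift x x = (1 + dual_eps A) *: Z by rewrite scalerDl scale1r.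
pose c := (1 + dual_eps A) ^+ d1.
have E k : (s 0 k, ddir t x y x k) = c * dual_const (s 0 k).
  rewrite -dual_mor Eshift -[map_mx _ y]scale1r (mor_atZZ _ _ _ _ hd) expr1n mulr1.
  by rewrite mxE -map_row_mx -map_mor_at mxE.
have [_ ->] := E j; have [_ ->] := E i0; rewrite /=; ring.
Qed.

(** Since x - x is the origin, a formula t representing this sum has a unit coordinate at [i0]. The
    index pair selects unit coordinates of x and of -x. *)
Lemma inv_chart_ex (phi : {rmorphism B -> A}) a x : point (geqs J) A x ->
  exists t u ik, [/\ t \in gadd J, u \in gopp J &
    ev phi x (inv_chart i0 a t u ik).1 \is a GRing.unit].
Proof.
move=> Px; have [[u uF pu] _ _] := (gopp_mor hJ).2 _ _ locA Px.
have [Py xy1] := opp_at Px uF pu.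
have [t [tF ts]] := mor_val_at xy1; have /existsP[i Ui] := point_prim Px.
have Us := prop_eq_unit (prop_eq_sym ts) gone_unit.
have /existsP[k Uk] := pu.
by exists t, u, (i, k); split=> //; rewrite inv_chart_den !unitrM /= Ui Uk Us.
Qed.

Lemma inv_chart_unit (phi : {rmorphism B -> A}) a t u ik x :
  ev phi x (inv_chart i0 a t u ik).1 \is a GRing.unit ->
  primitive (mor_at u x) /\ mor_at t (row_mx x (mor_at u x)) 0 i0 \is a GRing.unit.
Proof.
rewrite inv_chart_den unitrM => /andP[]; rewrite unitrM => /andP[_ Uk].
by rewrite unitrX_pos // => ->; split=> //; apply/existsP; exists ik.2.
Qed.
End OverA.

Lemma inv_charts_form (a : 'rV[B]_m.+1) : is_form p (geqs J) (inv_charts J i0 a).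
Proof.
split=> [c /inv_chartsP[t [u [ik [tF uF ->]]]]|A phi x locA Px].
  exact: (inv_chart_homog hJ).
split.
- have [t [u [ik [tF uF U]]]] := inv_chart_ex locA phi a Px.
  by exists (inv_chart i0 a t u ik) => //; apply/inv_chartsP; exists t, u, ik.
- move=> c /inv_chartsP[t [u [ik [tF uF ->]]]] U; rewrite (inv_chart_val x U) big1 // => j _.
  by rewrite ddir_self // mul0r mulr0.
move=> c c' /inv_chartsP[t [u [ik [tF uF ->]]]] /inv_chartsP[t' [u' [ik' [tF' uF' ->]]]].
move=> U U' v tv; apply: etrans (inv_chart_val v U) (etrans _ (esym (inv_chart_val v U'))).
 apply: eq_bigr => j _.
apply: (congr1 (fun z => phi (a 0 j) * z)).
have [pu Us] := inv_chart_unit U; have [pu' Us'] := inv_chart_unit U'.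
have [Py _] := opp_at locA Px uF pu.
have xx := prop_eq_refl (point_prim Px).
apply: (ddir_indep locA tF tF' Px Py _ tv Us Us').
exact: (proj_val_uniq locA (gopp_mor hJ) Px xx (mor_val_mor uF pu) (mor_val_mor uF' pu')).
Qed.

Definition inv_form a : regular_form p (geqs J) B := RegularForm (inv_charts_form a).
End InvariantFormP.

(** * p-adic integers *)

Section PadicIntegers.
Variables (p : nat) (Zp : idomainType) (red : {rmorphism Zp -> 'F_p}).
Hypotheses (hZ : is_padic_integers red) (pp : prime p).
Implicit Types x y : Zp.

Lemma p_neq0 : p%:R != 0 :> Zp. Proof. by case: hZ. Qed.

Lemma pX_neq0 k : p%:R ^+ k != 0 :> Zp. Proof. by rewrite expf_neq0 ?p_neq0. Qed.

Lemma red_eq0 x : red x = 0 <-> exists y, x = p%:R * y.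
Proof.
case: hZ => _ h _ _; rewrite h.
by split=> -[y ->]; exists y; rewrite ?expr1.
Qed.

Lemma red_p : red p%:R = 0.
Proof. by apply/red_eq0; exists 1; rewrite mulr1. Qed.

Lemma red_pX k : (0 < k)%N -> red (p%:R ^+ k) = 0.
Proof. by case: k => // k _; rewrite rmorphXn red_p expr0n. Qed.

Lemma padic_sep x : (forall k, exists y, x = p%:R ^+ k * y) -> x = 0.
Proof. by case: hZ => _ _ h _; apply: h. Qed.

Lemma nat_red x : exists n : nat, red x = n%:R.
Proof. by exists (red x : nat); rewrite natr_Zp. Qed.

Lemma nat_approx x k : exists (n : nat) y, x = n%:R + p%:R ^+ k * y.
Proof.
elim: k => [|k [n [y ->]]]; first by exists 0%N, x; rewrite expr0 mul1r add0r.
have [d Ed] := nat_red y.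
have /red_eq0[z Ez] : red (y - d%:R) = 0 by rewrite rmorphB rmorph_nat Ed subrr.
exists (n + p ^ k * d)%N, z; have -> : y = d%:R + p%:R * z by rewrite -Ez; ring.
by rewrite natrD natrM natrX exprS; ring.
Qed.

(** An inverse d modulo p gives x d = 1 - p t, and the geometric series in p t converges by
    completeness. *)
Lemma padic_unit x : (x \is a GRing.unit) = (red x != 0).
Proof.
apply/idP/idP => [Ux|nz]; first by rewrite -unitfE rmorph_unit.
have [d Ed] : exists d : nat, (red x)^-1 = d%:R.
  by exists ((red x)^-1 : 'F_p); rewrite natr_Zp.
have /red_eq0[t Et] : red (1 - x * d%:R) = 0.
  by rewrite rmorphB rmorph1 rmorphM rmorph_nat -Ed mulfV ?subrr.
pose u k := \sum_(i < k) (p%:R * t) ^+ i.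
have [l hl] : exists l, forall k, pdvd p k (l - u k).
  case: hZ => _ _ _ /(_ u); apply=> k; exists (t ^+ k).
  by rewrite /u big_ord_recr /= addrAC subrr add0r exprMn.
apply/unitrP; exists (d%:R * l); rewrite [_ * x]mulrC; suff e : x * (d%:R * l) = 1 by split.
apply/eqP; rewrite -subr_eq0; apply/eqP/padic_sep => k; have [z /eqP] := hl k.
rewrite subr_eq => /eqP->.
have /(congr1 -%R) := subrX1 (p%:R * t) k; rewrite -/(u k) => Eu.
have Ex : x * d%:R = 1 - p%:R * t by rewrite -Et; ring.
exists ((1 - p%:R * t) * z - t ^+ k); rewrite mulrA Ex mulrBr -exprMn.
by rewrite -[(p%:R * t) ^+ k](subrK 1) subrX1 -/(u k); ring.
Qed.

Lemma padic_nonunitP x : x \isn't a GRing.unit <-> exists y, x = p%:R * y.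
Proof. by rewrite padic_unit negbK -red_eq0; split=> /eqP. Qed.

Lemma padic_local : local_algebra p Zp.
Proof.
split=> [x y|q cqp]; rewrite !padic_unit.
  rewrite rmorphD; have [->|] := eqVneq (red x) 0; last by left.
  by rewrite add0r; right.
by rewrite rmorph_nat -unitfE unitFpE // coprime_sym.
Qed.

Lemma padic_unitD x y k : (0 < k)%N ->
  (x + p%:R ^+ k * y \is a GRing.unit) = (x \is a GRing.unit).
Proof. by move=> k0; rewrite !padic_unit rmorphD rmorphM red_pX // mul0r addr0. Qed.

Lemma padic_nat_neq0 n : (0 < n)%N -> n%:R != 0 :> Zp.
Proof.
move=> n0; have [q pq ->] := pfactor_coprime pp n0.
rewrite natrM natrX mulf_neq0 ?pX_neq0 //.
have : q%:R \is a @GRing.unit Zp by apply: (padic_local).2; rewrite coprime_sym.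
by apply: contraTneq => ->; rewrite unitr0.
Qed.

Lemma padic_intr_inj : injective (intr : int -> Zp).
Proof.
suff h z : z%:~R = 0 :> Zp -> z = 0.
  by move=> y z e; apply/eqP; rewrite -subr_eq0; apply/eqP/h; rewrite rmorphB /= e subrr.
case: z => [[|n]|n] // /eqP h; case/negP: (padic_nat_neq0 (ltn0Sn n)) => //.
by rewrite NegzE rmorphN oppr_eq0 in h.
Qed.

Lemma Qp_nat_neq0 n : (0 < n)%N -> n%:R != 0 :> Qp Zp.
Proof. by move/padic_nat_neq0; rewrite -tofrac_eq0 rmorph_nat. Qed.

Lemma Qp_sep (l : Qp Zp) : (forall e, exists y, l = tofrac (p%:R ^+ e * y)) -> l = 0.
Proof.
move=> h; have [x Ex] := h 0%N; rewrite Ex expr0 mul1r (_ : x = 0) ?rmorph0 //.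
apply: padic_sep => k; have [y] := h k; rewrite Ex expr0 mul1r => /eqP.
by rewrite tofrac_eq => /eqP; exists y.
Qed.

Lemma Qp_pX_neq0 k : p%:R ^+ k != 0 :> Qp Zp.
Proof. by rewrite expf_neq0 // Qp_nat_neq0 ?prime_gt0. Qed.

Lemma tofrac_pX k : p%:R ^+ k = tofrac (p%:R ^+ k) :> Qp Zp.
Proof. by rewrite rmorphXn rmorph_nat. Qed.

End PadicIntegers.

Section IntegralPoints.
Variables (p : nat) (Zp : idomainType) (red : {rmorphism Zp -> 'F_p}).
Hypotheses (hZ : is_padic_integers red) (pp : prime p).

Lemma intr_unitN (z : int) : z%:~R \is a @GRing.unit Zp -> ~~ (p%:Z %| z)%Z.
Proof.
rewrite (padic_unit hZ) // rmorph_int; apply: contra => /dvdzP[q ->].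
by rewrite rmorphM /= -pmulrn -(rmorph_nat red) (red_p hZ) mulr0.
Qed.

(** Formulas with integer coefficients send integer coordinates to integer coordinates, and the
    equations of the target descend because the integers embed in [Zp]. Hence morphisms preserve
    rational points. *)
Lemma zpoint_mor a b (dom : forall A : comUnitRingType, 'rV[A]_a -> Prop)
    (Y : seq {mpoly int[b]}) (F : morphism a b) (z : 'rV[int]_a) t :
  is_morphism p dom Y F -> dom Zp (intmx Zp z) -> t \in F ->
  primitive (mor_at t (intmx Zp z)) ->
  zpoint p Y (mor_at t z) /\ mor_at t (intmx Zp z) = intmx Zp (mor_at t z).
Proof.
move=> hF dz tF pt; have E := map_mor_at (intr : int -> Zp) t z.
have [_ /(_ t tF pt) Pt _] := hF _ _ (padic_local hZ pp) dz.
split; last exact: esym E.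
have /existsP[i Ui] := pt; split=> [|f fY].
  by exists i; apply: intr_unitN; move: Ui; rewrite /intmx -E mxE.
have [_ /(_ f fY)] := Pt; rewrite /intmx -E -ev_intr_morph.
by rewrite -(rmorph0 (intr : int -> Zp)) => /(padic_intr_inj hZ pp).
Qed.

Lemma rational_prop n X (x y : 'rV[Zp]_n) : (forall f, f \in X -> homogeneous f) ->
  prop_eq x y -> rational_point p X x -> rational_point p X y.
Proof.
move=> hX xy [Px [z Xz xz]]; split; first exact: point_prop xy Px.
exists z => //; have [_ _ //] : prop_eq y (intmx Zp z).
apply: prop_eq_trans (prop_eq_sym xy) _; split=> //; first by case: xy.
by apply: point_prim (zpoint_point pp (padic_local hZ pp) Xz).
Qed.

Lemma rational_prop_eq n X (x : 'rV[Zp]_n) : rational_point p X x ->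
  exists2 z, zpoint p X z & prop_eq x (intmx Zp z).
Proof.
move=> [[px _] [z Xz xz]]; exists z => //; split=> //.
by apply: point_prim (zpoint_point pp (padic_local hZ pp) Xz).
Qed.

Lemma zpoint_rational n X (z : 'rV[int]_n) : zpoint p X z -> rational_point p X (intmx Zp z).
Proof.
move=> Xz; have Pz := zpoint_point pp (padic_local hZ pp) Xz.
by split=> //; exists z => //; case: (prop_eq_refl (point_prim Pz)).
Qed.

Lemma rational_proj a b (X : seq {mpoly int[a]}) (Y : seq {mpoly int[b]}) F
    (x : 'rV[Zp]_a) y :
  (forall f, f \in X -> homogeneous f) -> (forall f, f \in Y -> homogeneous f) ->
  proj_morphism p X Y F -> rational_point p X x -> mor_val F x y -> rational_point p Y y.
Proof.
move=> hX hY hF Rx xy; have locZ := padic_local hZ pp.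
have [z Xz xz] := rational_prop_eq Rx; have Px := Rx.1.
have /mor_val_at[t [tF ty]] := proj_val_transfer locZ hF hX Px xz xy.
have [|Yt Et] := zpoint_mor hF.2 (zpoint_point pp locZ Xz) tF _; first by case: ty.
by apply: (rational_prop hY ty); rewrite Et; apply: zpoint_rational.
Qed.

Lemma rational_biproj a1 a2 b (X1 : seq {mpoly int[a1]}) (X2 : seq {mpoly int[a2]})
    (Y : seq {mpoly int[b]}) F (x : 'rV[Zp]_a1) (y : 'rV[Zp]_a2) w :
  (forall f, f \in X1 -> homogeneous f) -> (forall f, f \in X2 -> homogeneous f) ->
  (forall f, f \in Y -> homogeneous f) -> biproj_morphism p X1 X2 Y F ->
  rational_point p X1 x -> rational_point p X2 y ->
  mor_val F (row_mx x y) w -> rational_point p Y w.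
Proof.
move=> hX1 hX2 hY hF Rx Ry xyw; have locZ := padic_local hZ pp.
have [z Xz xz] := rational_prop_eq Rx; have [z' Xz' yz'] := rational_prop_eq Ry.
have Px := Rx.1; have Py := Ry.1.
have /mor_val_at[t [tF tw]] := biproj_val_transfer locZ hF hX1 hX2 Px Py xz yz' xyw.
have E : row_mx (intmx Zp z) (intmx Zp z') = intmx Zp (row_mx z z') by rewrite /intmx map_row_mx.
rewrite E in tw.
have [||Yt Et] := zpoint_mor hF.2 (z := row_mx z z') _ tF _.
- by rewrite -E; apply: pair_pointP; apply: (zpoint_point pp locZ).
- by case: tw.
by apply: (rational_prop hY tw); rewrite Et; apply: zpoint_rational.
Qed.

Lemma reduces_toP n (x y : 'rV[Zp]_n) :
  reduces_to red x (map_mx red y) <-> padic_close p 1 x y.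
Proof.
split=> [/forallP e i j|e].
  have /forallP/(_ j)/eqP := e i; rewrite !mxE -!rmorphM => /eqP.
  by rewrite -subr_eq0 -rmorphB => /eqP; case: hZ => _ h _ _; rewrite h.
apply/forallP=> i; apply/forallP=> j; rewrite !mxE -!rmorphM -subr_eq0 -rmorphB.
by apply/eqP; case: hZ => _ h _ _; apply/h/e.
Qed.
End IntegralPoints.

(** * The p-adic topology on J(Z_p) *)

Definition is_point_group (m : nat) (J : group_data m) (A : comUnitRingType) (G : zmodType)
    (rep : G -> 'rV[A]_m.+1) : Prop :=
  [/\ forall a, point (geqs J) A (rep a),
      forall x, point (geqs J) A x -> exists a, prop_eq (rep a) x,
      forall a b, prop_eq (rep a) (rep b) -> a = b,
      forall a b, add_rel J (rep a) (rep b) (rep (a + b)) &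
      prop_eq (rep 0) (intmx A (gone J))].

Section Congruence.
Variables (p g m : nat) (J : group_data m) (Zp : idomainType) (red : {rmorphism Zp -> 'F_p}).
Hypotheses (hJ : abelian_scheme p g J) (hZ : is_padic_integers red) (pp : prime p).
Variables (G : zmodType) (rep : G -> 'rV[Zp]_m.+1).
Hypothesis hG : is_point_group J rep.
Implicit Types (a b c : G) (x y z v w : 'rV[Zp]_m.+1).
Local Notation one := (intmx Zp (gone J)).
Local Notation at_ a x := (prop_eq (rep a) x).

Let locZ := padic_local hZ pp.

Lemma at_point a x : at_ a x -> point (geqs J) Zp x.
Proof. by case: hG => h _ _ _ _ ax; apply: (gpoint_prop hJ ax (h a)). Qed.

Lemma at_ex x : point (geqs J) Zp x -> exists a, at_ a x.
Proof. by case: hG => _ h _ _ _; apply: h. Qed.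

Lemma at_rep a : at_ a (rep a).
Proof. by apply: prop_eq_refl; case: hG => h _ _ _ _; case: (h a). Qed.

Lemma at_inj a b x y : at_ a x -> at_ b y -> prop_eq x y -> a = b.
Proof.
move=> ax by_ xy; case: hG => _ _ inj _ _; apply: inj.
by apply: prop_eq_trans ax (prop_eq_trans xy (prop_eq_sym by_)).
Qed.

Lemma at_0 : at_ 0 one. Proof. by case: hG. Qed.

Lemma at_add a b x y z : at_ a x -> at_ b y -> (at_ (a + b) z <-> add_rel J x y z).
Proof.
move=> ax by_; case: hG => _ _ _ /(_ a b) abc _.
have Pa := at_point (at_rep a); have Pb := at_point (at_rep b).
split=> [cz|xyz]; first exact: (add_transfer hJ locZ Pa Pb ax by_ cz abc).
exact: (add_uniq hJ locZ Pa Pb ax by_ abc xyz).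
Qed.

Lemma at_trans a x y : at_ a x -> prop_eq x y -> at_ a y.
Proof. exact: prop_eq_trans. Qed.

Lemma at_uniq a x y : at_ a x -> at_ a y -> prop_eq x y.
Proof. by move=> ax; apply: prop_eq_trans; apply: prop_eq_sym. Qed.

(** Congruence modulo p^k through suitable representatives, the shape to which Taylor expansions
    apply; [padic_closeP] identifies it with the divisibility of the minors. *)
Definition cong k a b := exists x v, at_ a x /\ at_ b (x + p%:R ^+ k *: v).

Lemma padic_closeP k a b x y : at_ a x -> at_ b y -> (padic_close p k x y <-> cong k a b).
Proof.
move=> ax by_; split=> [xy|[x' [v [ax' bv]]] i j]; last first.
  have [_ [c Uc ->]] := (prop_eqP _ _).1 (at_uniq ax' ax).
  have [_ [d Ud ->]] := (prop_eqP _ _).1 (at_uniq bv by_).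
  exists (c * d * (x' 0 i * v 0 j - x' 0 j * v 0 i)); rewrite !mxE; ring.
case: k xy => [|k] xy.
  by exists x, (y - x); rewrite expr0 scale1r addrC subrK.
have [i Ui] := existsP (point_prim (at_point ax)).
have [j Uj] := existsP (point_prim (at_point by_)).
(* The unit x_i y_j differs from x_j y_i by a multiple of p, so y_i is a unit as well and both
   points lie in the same affine chart. *)
have Uyi : y 0 i \is a GRing.unit.
  have [w Ew] := xy i j; have Uij : x 0 i * y 0 j \is a GRing.unit by rewrite unitrM Ui Uj.
  move: Uij; rewrite -[x 0 i * _](subrK (x 0 j * y 0 i)) Ew addrC.
  by rewrite (padic_unitD hZ) // unitrM => /andP[].
have [w Ew] := fin_all_exists (fun j => xy i j).
exists x, (\row_j (w j / y 0 i)); split=> //.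
apply: (at_trans by_); have Uc : x 0 i / y 0 i \is a GRing.unit by rewrite unitrM Ui unitrV.
have -> : x + p%:R ^+ k.+1 *: \row_j (w j / y 0 i) = (x 0 i / y 0 i) *: y.
  apply/rowP=> l; rewrite !mxE mulrA -Ew; apply: (mulIr Uyi).
  by rewrite mulrDl divrK // mulrAC divrK //; ring.
by apply: prop_eqZ => //; case: by_.
Qed.

Lemma cong_refl k a : cong k a a.
Proof. by exists (rep a), 0; rewrite scaler0 addr0; split; apply: at_rep. Qed.

Lemma cong_sym k a b : cong k a b -> cong k b a.
Proof.
move=> [x [v [ax bv]]]; exists (x + p%:R ^+ k *: v), (- v); split=> //.
by rewrite scalerN addrK.
Qed.

Lemma cong_trans k a b c : cong k a b -> cong k b c -> cong k a c.
Proof.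
move=> [x [v [ax bv]]] [y [w [by_ cw]]].
have [_ [d Ud Ey]] := (prop_eqP _ _).1 (at_uniq bv by_).
exists x, (v + d^-1 *: w); split=> //; apply: (at_trans cw); rewrite Ey.
have -> : x + p%:R ^+ k *: (v + d^-1 *: w) = d^-1 *: (d *: (x + p%:R ^+ k *: v) + p%:R ^+ k *: w).
  by rewrite [RHS]scalerDr scalerA mulVr // scale1r scalerDr addrA !scalerA mulrC.
rewrite -Ey; apply: prop_eqZ; rewrite ?unitrV //.
by case: cw.
Qed.

Lemma cong_le k l a b : (k <= l)%N -> cong l a b -> cong k a b.
Proof.
move=> kl [x [v [ax bv]]]; exists x, (p%:R ^+ (l - k) *: v); split=> //.
by rewrite scalerA -exprD subnKC.
Qed.

(** A formula valid at (a, c) remains valid after a perturbation by a positive power of p, units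
    being detected modulo p. Its first-order expansion then gives the congruence. *)
Lemma cong_add k a b c : cong k a b -> cong k (a + c) (b + c).
Proof.
case: k => [_|k [x [v [ax bv]]]].
  exists (rep (a + c)), (rep (b + c) - rep (a + c)).
  by rewrite expr0 scale1r [rep _ + _]addrC subrK; split; apply: at_rep.
have /(at_add _ ax (at_rep c))/mor_val_at[t [tF ts]] := at_rep (a + c).
pose y := rep c; set X := x + _ in bv.
have [w Ew] := fin_all_exists (fun j => mor_taylor_l t x y v (p%:R ^+ k.+1) j).
have Et : mor_at t (row_mx X y) = mor_at t (row_mx x y) + p%:R ^+ k.+1 *:
    \row_j (ddir t x y v j + p%:R ^+ k.+1 * w j).
  by apply/rowP=> j; rewrite Ew !mxE; ring.
have pX : primitive (mor_at t (row_mx X y)).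
  have [/existsP[i Ui] _ _] := ts; apply/existsP; exists i.
  by rewrite Et mxE [X in _ + X]mxE (padic_unitD hZ).
exists (mor_at t (row_mx x y)), (\row_j (ddir t x y v j + p%:R ^+ k.+1 * w j)).
split; first exact: prop_eq_sym.
by rewrite -Et; apply/(at_add _ bv (at_rep c)); apply: mor_val_mor.
Qed.

Lemma cong_sub0 k a b : cong k a b <-> cong k (a - b) 0.
Proof.
split=> [/(cong_add (- b))|/(cong_add b)]; first by rewrite subrr.
by rewrite subrK add0r.
Qed.

Lemma cong_add2 k a b a' b' : cong k a b -> cong k a' b' -> cong k (a + a') (b + b').
Proof.
move=> ab ab'; apply: cong_trans (cong_add a' ab) _.
by rewrite ![b + _]addrC; apply: cong_add.
Qed.

Lemma cong_mul k a b n : cong k a b -> cong k (a *+ n) (b *+ n).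
Proof.
move=> ab; elim: n => [|n IH]; first exact: cong_refl.
by rewrite !mulrS; apply: cong_add2.
Qed.

(** Pigeonhole: among sufficiently many multiples of a, two have the same coordinate vector over
    'F_p, and their difference lies in the kernel of reduction. *)
Lemma torsion_mod_p a : exists2 n, (0 < n)%N & cong 1 (a *+ n) 0.
Proof.
pose N := #|{: 'rV['F_p]_m.+1}|; pose f (i : 'I_N.+1) := map_mx red (rep (a *+ i)).
have /injectivePn[i [j ne_ij e]] : ~~ injectiveb f.
  by apply/injectiveP => /leq_card; rewrite card_ord ltnn.
wlog lt_ij : i j ne_ij e / (i < j)%N => [hw|].
  case: (ltngtP i j) => [/hw|/hw|/val_inj ij]; first exact.
    by apply; rewrite // eq_sym.
  by rewrite ij eqxx in ne_ij.
exists (j - i)%N; first by rewrite subn_gt0.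
rewrite mulrnBr ?(ltnW lt_ij) //; apply: (cong_sub0 _ _ _).1.
apply/(padic_closeP 1 (at_rep _) (at_rep _))/(reduces_toP hZ).
suff [_ _ h] : prop_eq (f j) (f i) by exact: h.
rewrite e; apply: prop_eq_refl; apply: map_primitive.
by apply: point_prim (at_point (at_rep _)).
Qed.

Lemma at_sum a x n z : at_ a x -> at_ (a *+ n) z -> sum_rel J (nseq n x) z.
Proof.
move=> ax; elim: n z => [|n IH] z /=.
  by move=> z0; have [_ pz e] := at_uniq at_0 z0.
rewrite mulrS => az; exists (rep (a *+ n)); first exact: IH (at_rep _).
by apply/(at_add _ ax (at_rep _)).
Qed.

Lemma M_at a x y : at_ a x -> at_ a y -> M p J x -> M p J y.
Proof.
move=> ax ay [Px hx]; split; first exact: at_point ay.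
move=> e; have [T RT xT] := hx e; exists T => //.
have [b bT] := at_ex RT.1.
by apply/(padic_closeP e ay bT)/(padic_closeP e ax bT).
Qed.

Lemma M_limitP a : M p J (rep a) <->
  forall e, exists2 b, rational_point p (geqs J) (rep b) & cong e a b.
Proof.
split=> [[Pa ha] e|ha].
  have [T RT aT] := ha e; have [b bT] := at_ex RT.1; exists b.
    by apply: (rational_prop hZ pp (geqs_homog hJ) (prop_eq_sym bT)).
  by apply/(padic_closeP e (at_rep a) bT).
split=> [|e]; first exact: at_point (at_rep a).
have [b Rb ab] := ha e; exists (rep b) => //.
by apply/(padic_closeP e (at_rep a) (at_rep b)).
Qed.

Lemma rational_0 : rational_point p (geqs J) (rep 0).
Proof.
apply: (rational_prop hZ pp (geqs_homog hJ) (prop_eq_sym at_0)).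
by apply: (zpoint_rational hZ pp); case: hJ.
Qed.

Lemma rational_add a b : rational_point p (geqs J) (rep a) ->
  rational_point p (geqs J) (rep b) -> rational_point p (geqs J) (rep (a + b)).
Proof.
move=> Ra Rb; have hh := geqs_homog hJ.
apply: (rational_biproj hZ pp hh hh hh (gadd_mor hJ) Ra Rb).
by apply/(at_add _ (at_rep a) (at_rep b))/at_rep.
Qed.

Lemma M_rational a : rational_point p (geqs J) (rep a) -> M p J (rep a).
Proof. by move=> Ra; apply/M_limitP => e; exists a => //; apply: cong_refl. Qed.

Lemma M_add a b : M p J (rep a) -> M p J (rep b) -> M p J (rep (a + b)).
Proof.
move=> /M_limitP ha /M_limitP hb; apply/M_limitP => e.
have [a' Ra aa'] := ha e; have [b' Rb bb'] := hb e.
by exists (a' + b'); [apply: rational_add | apply: cong_add2].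
Qed.

Lemma M_mul a n : M p J (rep a) -> M p J (rep (a *+ n)).
Proof.
move=> Ma; elim: n => [|n IH]; first exact: M_rational rational_0.
by rewrite mulrS; apply: M_add.
Qed.

Lemma M_closed a : (forall e, (0 < e)%N -> exists2 b, M p J (rep b) & cong e a b) -> M p J (rep a).
Proof.
(* Approximations are available only for positive exponents, so both are taken at e + 1. *)
move=> h; apply/M_limitP => e; have [b /M_limitP/(_ e.+1)[c Rc bc] ab] := h e.+1 isT.
by exists c => //; apply: (cong_le (leqnSn e)); apply: cong_trans bc.
Qed.

Lemma J0P a x : at_ a x -> (J0 red J x <-> cong 1 a 0).
Proof.
move=> ax; have E : intmx 'F_p (gone J) = map_mx red one by rewrite map_intmx.
split=> [[_]|h]; first by rewrite E => /(reduces_toP hZ)/(padic_closeP 1 ax at_0).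
split; first exact: at_point ax.
by rewrite E; apply/(reduces_toP hZ)/(padic_closeP 1 ax at_0).
Qed.
End Congruence.

(** * Multiplication by p near the origin *)

Section FormalGroup.
Variables (p g m : nat) (J : group_data m) (Zp : idomainType) (red : {rmorphism Zp -> 'F_p}).
Hypotheses (hJ : abelian_scheme p g J) (hZ : is_padic_integers red) (pp : prime p) (p2 : (2 < p)%N).
Variables (G : zmodType) (rep : G -> 'rV[Zp]_m.+1).
Hypothesis hG : is_point_group J rep.
Variable i0 : 'I_m.+1.
Hypothesis hi0 : ~~ (p%:Z %| gone J ord0 i0)%Z.
Implicit Types (a b c : G) (x y z u v w : 'rV[Zp]_m.+1).
Local Notation one := (intmx Zp (gone J)).
Local Notation at_ a x := (prop_eq (rep a) x).

Let locZ := padic_local hZ pp.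
Let one_unit : one 0 i0 \is a GRing.unit := gone_unit pp hi0 locZ.

(* Coordinates are taken in the affine chart X_i0 = (gone J)_i0. *)
Definition scaled_coord k a u := u 0 i0 = 0 /\ at_ a (one + p%:R ^+ k *: u).

Lemma cong_coord k a : (0 < k)%N -> cong p rep k a 0 -> exists u, scaled_coord k a u.
Proof.
move=> k0 /cong_sym[x [v [ox av]]].
have [_ [d Ud Ex]] := (prop_eqP _ _).1 (at_uniq (at_0 hG) ox).
(* The coordinate of [d *: one + p^k *: v] at [i0]; rescaling by its ratio to the coordinate of the
   origin returns to the affine chart. *)
pose d1 := d * one 0 i0 + p%:R ^+ k * v 0 i0.
have U1 : d1 \is a GRing.unit by rewrite (padic_unitD hZ) // unitrM Ud.
exists (\row_j ((v 0 j * one 0 i0 - one 0 j * v 0 i0) / d1)); split.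
  by rewrite mxE [one 0 i0 * _]mulrC subrr mul0r.
apply: (at_trans av); rewrite Ex.
have -> : one + p%:R ^+ k *: \row_j ((v 0 j * one 0 i0 - one 0 j * v 0 i0) / d1) =
    (one 0 i0 / d1) *: (d *: one + p%:R ^+ k *: v).
  apply/rowP=> j; apply: (mulIr U1); rewrite !mxE mulrDl mulrA divrK //.
  by rewrite mulrAC divrK // /d1 mxE; ring.
apply: prop_eqZ; first by rewrite unitrM one_unit unitrV.
by rewrite -Ex; case: av.
Qed.

(** The formal group law to second order. The linear part is u + v because x + 0 = x and 0 + y = y.
    The quadratic part B does not depend on k and is linear in its first argument, which lets
    multiplication by n be computed by induction. *)
Lemma coord_add : exists B : 'rV[Zp]_m.+1 -> 'rV[Zp]_m.+1 -> 'rV[Zp]_m.+1,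
  (forall q u v w, B (q *: u + v) w = q *: B u w + B v w) /\
  forall k a b u v, (0 < k)%N -> scaled_coord k a u -> scaled_coord k b v ->
    exists w, scaled_coord k (a + b) (u + v + p%:R ^+ k *: B u v + p%:R ^+ k ^+ 2 *: w).
Proof.
have P1 := gone_point hJ pp locZ; have o1 := at_0 hG.
have [t [tF t11]] := mor_val_at (add_one hJ locZ P1).
have [c Hc] := fin_all_exists (fun j => ev_mixed_taylor one one (tnth t j)).
have [l1 Hl1] := fin_all_exists Hc; have [l2 Hl2] := fin_all_exists Hl1.
have [T HT] := fin_all_exists Hl2; move=> {Hc Hl1 Hl2}.
have LT j q u v w : T j (q *: u + v) w = q * T j u w + T j v w by case: (HT j).
have HE j q u v : exists e1 e2 e3,
  [/\ mor_at t (row_mx (one + q *: u) one) 0 j = c j + q * l1 j u + q ^+ 2 * e1,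
      mor_at t (row_mx one (one + q *: v)) 0 j = c j + q * l2 j v + q ^+ 2 * e2,
      mor_at t (row_mx (one + q *: u) (one + q *: v)) 0 j =
        mor_at t (row_mx (one + q *: u) one) 0 j + mor_at t (row_mx one (one + q *: v)) 0 j
        - c j + q ^+ 2 * T j u v + q ^+ 3 * e3,
      mor_at t (row_mx one one) 0 j = c j &
      l1 j (q *: u + v) = q * l1 j u + l1 j v].
  by have [_ /(_ q u v)] := HT j; rewrite !mxE.
have Ll q u v : l1 i0 (q *: u + v) = q * l1 i0 u + l1 i0 v.
  by have [? [? [? []]]] := HE i0 q u v.
have Ec j : mor_at t (row_mx one one) 0 j = c j.
  by have [? [? [? []]]] := HE j 0 0 0.
have Uc : c i0 \is a GRing.unit by rewrite -Ec; apply: prop_eq_unit (prop_eq_sym t11) one_unit.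
have cE j : c j * one 0 i0 = c i0 * one 0 j by rewrite -!Ec; apply: prop_eqE.
(* The coefficient of q^2 mixing u and v in s_j / s_i0, normalised to the chart: the terms in T come
   from the mixed expansion of s, the last two from dividing by s_i0. *)
pose B (u v : 'rV[Zp]_m.+1) : 'rV[Zp]_m.+1 := \row_j ((c i0)^-1 * (one 0 i0 * T j u v - one 0 j * T i0 u v
  - l2 i0 v * u 0 j - l1 i0 u * v 0 j)).
exists B; split=> [q u v w|k a b u v k0 [u0 au] [v0 bv]].
  by apply/rowP=> j; rewrite !mxE !LT Ll; ring.
set q := p%:R ^+ k in au bv *; pose x := one + q *: u; pose y := one + q *: v.
pose s := mor_at t (row_mx x y).
have [k1 [k2 [k3 [K1 K2 K3 _ _]]]] := HE i0 q u v.
pose gam := l1 i0 u + l2 i0 v + q * k1 + q * k2 + q * T i0 u v + q ^+ 2 * k3.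
have Es0 : s 0 i0 = c i0 + q * gam by rewrite /s K3 K1 K2 /gam; ring.
have Us : s 0 i0 \is a GRing.unit by rewrite Es0 (padic_unitD hZ).
have ps : primitive s by apply/existsP; exists i0.
have abs : at_ (a + b) s by apply/(at_add hJ hZ pp hG s au bv)/(mor_val_mor tF).
have x0 : x 0 i0 = one 0 i0 by rewrite /x mxE [X in _ + X]mxE u0 mulr0 addr0.
have y0 : y 0 i0 = one 0 i0 by rewrite /y mxE [X in _ + X]mxE v0 mulr0 addr0.
have xj j : x 0 j = one 0 j + q * u 0 j by rewrite /x mxE [X in _ + X]mxE.
have yj j : y 0 j = one 0 j + q * v 0 j by rewrite /y mxE [X in _ + X]mxE.
(* The relation x + 0 = x holds to all orders in q, so it accounts for every term in u alone; [Ey]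
   does the same for v, and only mixed terms remain. *)
have Ex j : mor_at t (row_mx x one) 0 j * one 0 i0 = mor_at t (row_mx x one) 0 i0 * x 0 j.
  rewrite -x0; apply: prop_eqE; suff h : at_ a (mor_at t (row_mx x one)) by exact: (at_uniq h au).
  rewrite -[a]addr0; apply/(at_add hJ hZ pp hG _ au o1)/(mor_val_mor tF).
  apply/existsP; exists i0; rewrite K1 -addrA [q ^+ 2]expr2 -mulrA -mulrDr.
  by rewrite (padic_unitD hZ).
have Ey j : mor_at t (row_mx one y) 0 j * one 0 i0 = mor_at t (row_mx one y) 0 i0 * y 0 j.
  rewrite -y0; apply: prop_eqE; suff h : at_ b (mor_at t (row_mx one y)) by exact: (at_uniq h bv).
  rewrite -[b]add0r; apply/(at_add hJ hZ pp hG _ o1 bv)/(mor_val_mor tF).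
  apply/existsP; exists i0; rewrite K2 -addrA [q ^+ 2]expr2 -mulrA -mulrDr.
  by rewrite (padic_unitD hZ).
have key j : exists w : Zp, s 0 j * one 0 i0 =
    s 0 i0 * (one 0 j + q * (u 0 j + v 0 j + q * B u v 0 j + q ^+ 2 * w)).
  have [_ [_ [e3 [_ _ E3 _ _]]]] := HE j q u v.
  pose B' := one 0 i0 * T j u v - one 0 j * T i0 u v - l2 i0 v * u 0 j - l1 i0 u * v 0 j.
  have EB : B u v 0 j = (c i0)^-1 * B' by rewrite mxE.
  have EB' : B' = c i0 * B u v 0 j by rewrite EB mulVKr.
  pose w' := one 0 i0 * e3 - k3 * one 0 j - u 0 j * k2 - v 0 j * k1
    - (u 0 j + v 0 j) * (T i0 u v + q * k3).
  exists ((s 0 i0)^-1 * (w' - gam * B u v 0 j)).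
  have -> : s 0 i0 * (one 0 j + q * (u 0 j + v 0 j + q * B u v 0 j +
      q ^+ 2 * ((s 0 i0)^-1 * (w' - gam * B u v 0 j)))) =
      s 0 i0 * (one 0 j + q * (u 0 j + v 0 j + q * B u v 0 j)) + q ^+ 3 * (w' - gam * B u v 0 j).
    rewrite -{2}[w' - _](mulKr Us) mulrA; ring.
  have -> : s 0 i0 * (one 0 j + q * (u 0 j + v 0 j + q * B u v 0 j)) + q ^+ 3 * (w' - gam * B u v 0 j)
     = s 0 i0 * (one 0 j + q * (u 0 j + v 0 j)) + q ^+ 2 * B' + q ^+ 3 * w'.
    by rewrite EB' Es0; ring.
  have := Ex j; have := Ey j; have := cE j; rewrite xj yj => H0 H2 H1.
  have -> : s 0 j * one 0 i0 = mor_at t (row_mx x one) 0 j * one 0 i0 +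
     mor_at t (row_mx one y) 0 j * one 0 i0 - c j * one 0 i0 + q ^+ 2 * T j u v * one 0 i0
     + q ^+ 3 * e3 * one 0 i0 by rewrite /s E3; ring.
  rewrite H0 H1 H2 /s K3 K1 K2 /w' /B'; ring.
have [w Ew] := fin_all_exists key; pose w1 := \row_j w j.
have rE (o d e f h : 'rV[Zp]_m.+1) j : (o + q *: (d + e + q *: f + q ^+ 2 *: h)) 0 j =
    o 0 j + q * (d 0 j + e 0 j + q * f 0 j + q ^+ 2 * h 0 j) by rewrite !mxE.
have EW : (one 0 i0 / s 0 i0) *: s =
    one + q *: (u + v + q *: B u v + q ^+ 2 *: w1).
  apply/rowP=> j; rewrite [LHS]mxE; apply: (mulIr Us); rewrite mulrAC divrK // mulrC Ew mulrC.
  by rewrite rE [w1 0 j]mxE.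
have abw : at_ (a + b) (one + q *: (u + v + q *: B u v + q ^+ 2 *: w1)).
  apply: (at_trans abs); rewrite -EW; apply: prop_eqZ => //.
  by rewrite unitrM one_unit unitrV.
exists w1; split=> //; have := congr1 (fun r : 'rV_m.+1 => r 0 i0) EW.
rewrite [LHS]mxE divrK // [RHS]mxE [X in _ + X]mxE => /eqP.
rewrite -[X in X == _]addr0 (inj_eq (addrI _)) eq_sym mulf_eq0 (negPf (pX_neq0 hZ k)) /=.
by move/eqP.
Qed.

(* Since p is odd, p divides 'C(p, 2), the coefficient of the quadratic term
   of multiplication by p. *)
Lemma coord_mulp k a u : (0 < k)%N -> scaled_coord k a u ->
  exists w, scaled_coord k.+1 (a *+ p) (u + p%:R *: w).
Proof.
case: coord_add => B [LB addB] k0 au.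
have LB0 w : B 0 w = 0.
  by have := LB (-1) 0 0 w; rewrite scaler0 addr0 scaleN1r addNr.
have LBZ r x y : B (r *: x) y = r *: B x y.
  by have := LB r x 0 y; rewrite addr0 LB0 addr0.
pose q : Zp := p%:R ^+ k.
(* Adding a once more contributes B(n u, u) = n B(u, u), and 'C(n, 2) + n = 'C(n + 1, 2). *)
have mulB n : exists w, scaled_coord k (a *+ n)
    (n%:R *: u + q *: ('C(n, 2)%:R *: B u u) + q ^+ 2 *: w).
  elim: n => [|n [w IH]].
    exists 0; rewrite !scale0r !scaler0 !addr0; split; first by rewrite mxE.
    by rewrite scaler0 addr0; apply: at_0 hG.
  have [w' aw'] := addB _ _ _ _ _ k0 IH au.
  pose y := 'C(n, 2)%:R *: B u u + q *: w.
  exists (w + w' + B y u); rewrite mulrSr.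
  suff -> : n.+1%:R *: u + q *: ('C(n.+1, 2)%:R *: B u u) + q ^+ 2 *: (w + w' + B y u) =
    n%:R *: u + q *: ('C(n, 2)%:R *: B u u) + q ^+ 2 *: w + u +
    q *: B (n%:R *: u + q *: ('C(n, 2)%:R *: B u u) + q ^+ 2 *: w) u + q ^+ 2 *: w' by [].
  have -> : n%:R *: u + q *: ('C(n, 2)%:R *: B u u) + q ^+ 2 *: w = n%:R *: u + q *: y.
    by rewrite /y; apply/rowP=> j; rewrite !mxE; ring.
  rewrite LB LBZ binS bin1 natrD -natr1 /y.
  apply/rowP=> j; rewrite !mxE; ring.
have [w aw] := mulB p.
have [C EC] : exists C, 'C(p, 2) = (p * C)%N.
  by have /dvdnP[C ->] := prime_dvd_bin pp (p2 : (0 < 2 < p)%N); exists C; rewrite mulnC.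
have Eq : q = p%:R * p%:R ^+ k.-1 by rewrite -exprS prednK.
(* After one factor p is moved into the scale, the error must retain another. In the tight case k =
   1 the quadratic term is p 'C(p, 2) = p^2 C and the remainder carries q^2 = p^2. *)
exists (p%:R ^+ k.-1 *: (C%:R *: B u u) + p%:R ^+ k.-1 ^+ 2 *: w).
set v := u + _; have Ev : p%:R *: v =
    p%:R *: u + q *: ('C(p, 2)%:R *: B u u) + q ^+ 2 *: w.
  by rewrite /v EC natrM Eq; apply/rowP=> j; rewrite !mxE; ring.
case: aw; rewrite -Ev => v0 av; split; last by rewrite exprSr -scalerA.
by move/eqP: v0; rewrite mxE mulf_eq0 (negPf (p_neq0 hZ)) => /eqP.
Qed.

Lemma coord_mulpX k a u n : (0 < k)%N -> scaled_coord k a u ->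
  exists w, scaled_coord (k + n) (a *+ p ^ n) (u + p%:R *: w).
Proof.
move=> k0 au; elim: n => [|n [w IH]].
  by exists 0; rewrite scaler0 !addr0 addn0 expn0 mulr1n.
have [|w' aw'] := coord_mulp _ IH; first by rewrite addn_gt0 k0.
by exists (w + w'); rewrite addnS expnSr mulrnA scalerDr addrA.
Qed.
End FormalGroup.

(** * Coleman integrals *)

Section Coleman.
Variables (p g m : nat) (J : group_data m) (Zp : idomainType) (red : {rmorphism Zp -> 'F_p}).
Hypotheses (hJ : abelian_scheme p g J) (hZ : is_padic_integers red) (pp : prime p) (p2 : (2 < p)%N).
Variables (G : zmodType) (rep : G -> 'rV[Zp]_m.+1).
Hypothesis hG : is_point_group J rep.
Variable i0 : 'I_m.+1.
Hypothesis hi0 : ~~ (p%:Z %| gone J ord0 i0)%Z.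
Variable integral : regular_form p (geqs J) Zp -> 'rV[Zp]_m.+1 -> Qp Zp.
Hypothesis hI : forall w, is_coleman_integral w (integral w).
Implicit Types (a b : G) (x y z u v : 'rV[Zp]_m.+1) (w : regular_form p (geqs J) Zp).
Local Notation one := (intmx Zp (gone J)).
Local Notation at_ a x := (prop_eq (rep a) x).
Local Notation scaled_coord := (scaled_coord p J rep i0).
Local Notation cong := (cong p rep).

Let locZ := padic_local hZ pp.
Let P1 : point (geqs J) Zp one := gone_point hJ pp locZ.
Let one_unit : one 0 i0 \is a GRing.unit := gone_unit pp hi0 locZ.

Definition coleman w a := integral w (rep a).

Lemma integral_one w : integral w one = 0.
Proof.
have e := (hI w).1 _ _ _ P1 P1 (add_one hJ locZ P1).
by apply: (addrI (integral w one)); rewrite -e addr0.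
Qed.

(** [integral] is a function of coordinate vectors; additivity applied to 0 + a = x shows that it
    depends only on the projective class. *)
Lemma coleman_at w a x : at_ a x -> integral w x = coleman w a.
Proof.
move=> ax; have o1 := at_0 hG; have ar := at_rep hG a.
have h : add_rel J one (rep a) x by apply/(at_add hJ hZ pp hG x o1 ar); rewrite add0r.
by rewrite ((hI w).1 _ _ _ P1 (at_point hJ hG ar) h) integral_one add0r.
Qed.

Lemma colemanD w a b : coleman w (a + b) = coleman w a + coleman w b.
Proof.
have ar := at_rep hG a; have br := at_rep hG b.
apply: (hI w).1 (at_point hJ hG ar) (at_point hJ hG br) _.
exact/(at_add hJ hZ pp hG _ ar br)/(at_rep hG).
Qed.

Lemma coleman_local w (c : chart Zp m.+1) : c \in charts w -> ev id one c.1 \is a GRing.unit ->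
  forall e, exists K, forall k a u, (K <= k)%N -> scaled_coord k a u -> exists r,
    coleman w a = tofrac (p%:R ^+ k * chart_val id c one u + p%:R ^+ (k + e) * r).
Proof.
move=> cw Uc e; have [K hK] := (hI w).2 one c P1 cw Uc e; exists K => k a u Kk [_ au].
have [r] := hK k u Kk (at_point hJ hG au); rewrite integral_one subr0 (coleman_at _ au).
by exists r.
Qed.

Section Additive.
Variable mu : G -> Qp Zp.
Hypothesis muD : forall a b, mu (a + b) = mu a + mu b.

Lemma additive0 : mu 0 = 0.
Proof. by apply: (addrI (mu 0)); rewrite -muD !addr0. Qed.

Lemma additiveMn a n : mu (a *+ n) = n%:R * mu a.
Proof.
elim: n => [|n IH]; first by rewrite mulr0n mul0r additive0.
by rewrite mulrS muD IH -[n.+1]add1n natrD mulrDl mul1r.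
Qed.

(** A homomorphism with zero differential at the origin vanishes. Some multiple n a reduces to 0,
    and p^K n a is deep enough for the estimate; cancelling p^K shows that n mu(a) is divisible by
    p^e for every e. *)
Lemma additive_eq0 :
  (forall e, exists K, forall k a u, (K <= k)%N -> scaled_coord k a u ->
     exists r, mu a = tofrac (p%:R ^+ (k + e) * r)) ->
  forall a, mu a = 0.
Proof.
move=> h a; have [n n0 ha] := torsion_mod_p hJ hZ pp hG a.
have [u au] := cong_coord hZ pp hG hi0 (ltn0Sn 0) ha.
suff /eqP : n%:R * mu a = 0.
  by rewrite mulf_eq0 (negPf (Qp_nat_neq0 hZ pp n0)) => /eqP.
apply: (Qp_sep hZ) => e; have [K hK] := h e.
have [v av] := coord_mulpX hJ hZ pp p2 hG hi0 K (ltn0Sn 0) au.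
have [r] := hK _ _ _ (leq_addl 1 K) av; rewrite !additiveMn natrX => Er.
exists (p%:R * r); apply: (mulfI (Qp_pX_neq0 hZ pp K)); rewrite Er.
by rewrite tofrac_pX -tofracM; congr tofrac; rewrite !exprD expr1; ring.
Qed.
End Additive.

Local Notation omega r := (inv_form (B := Zp) hJ pp hi0 r).
(** The invariant forms of the standard basis of ambient covectors. They need not be linearly
    independent: the one for [j = i0] is zero. *)
Definition basis_form j := omega (delta_mx 0 j).

(** The denominator of [inv_chart] does not involve the covector, so a single chart at the origin
    serves all the forms simultaneously. *)
Lemma chart_at_one : exists t f ik, [/\ t \in gadd J, f \in gopp J &
  forall r, ev idfun one (inv_chart i0 r t f ik).1 \is a GRing.unit].
Proof.
have [t [f [ik [tF uF U]]]] := inv_chart_ex hJ pp hi0 locZ idfun (0 : 'rV[Zp]_m.+1) P1.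
by exists t, f, ik; split=> // r; rewrite inv_chart_den in U *.
Qed.

Lemma inv_chart_omega r t f ik : t \in gadd J -> f \in gopp J ->
  inv_chart i0 r t f ik \in charts (omega r).
Proof. by move=> tF uF; apply/inv_chartsP; exists t, f, ik. Qed.

(** Here v is the displacement to a nearby point and is tangent only up to p^k, whence the error
    term. Expanding X + 0 = X to first order and dividing by p^k shows that the derivative of
    addition in its first argument is the identity modulo p^k. *)
Lemma inv_chart_one r t f ik k b v : t \in gadd J -> f \in gopp J ->
  ev idfun one (inv_chart i0 r t f ik).1 \is a GRing.unit ->
  (0 < k)%N -> scaled_coord k b v ->
  exists h, chart_val idfun (inv_chart i0 r t f ik) one v =
    (one 0 i0)^-1 * (\sum_j r 0 j * v 0 j) + p%:R ^+ k * h.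
Proof.
move=> tF uF U k0 [v0 bv]; rewrite (inv_chart_val v U).
have [pu Us] := inv_chart_unit U; have [Py one_y] := opp_at hJ locZ P1 uF pu.
move: Py one_y Us; set y := mor_at f one; set s := mor_at t _ => Py one_y Us.
have o1 := at_0 hG; have [c cy] := at_ex hG Py.
have c0 : c = 0.
  rewrite -[c]add0r; have h : at_ (0 + c) one by apply/(at_add hJ hZ pp hG _ o1 cy).
  exact: (at_inj hG h o1 (prop_eq_refl (point_prim P1))).
move: cy; rewrite c0 => {c c0} oy; set q := p%:R ^+ k in bv *.
have sone : prop_eq s one.
  have h : at_ (0 + 0) s.
    by apply/(at_add hJ hZ pp hG _ o1 oy)/(mor_val_mor tF)/existsP; exists i0.
  by rewrite addr0 in h; exact: (at_uniq h o1).
pose X := one + q *: v.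
have [h Eh] := fin_all_exists (fun j => mor_taylor_l t one y v q j).
have tX : prop_eq (mor_at t (row_mx X y)) X.
  suff h1 : at_ (b + 0) (mor_at t (row_mx X y)) by rewrite addr0 in h1; exact: (at_uniq h1 bv).
  apply/(at_add hJ hZ pp hG _ bv oy)/(mor_val_mor tF)/existsP; exists i0.
  by rewrite Eh -/s expr2 -addrA -mulrA -mulrDr (padic_unitD hZ).
have Xj j : X 0 j = one 0 j + q * v 0 j by rewrite /X mxE [X in _ + X]mxE.
have D_eq j : ddir t one y v j * one 0 i0 - ddir t one y v i0 * one 0 j = s 0 i0 * v 0 j +
   q * (ddir t one y v i0 * v 0 j + h i0 * one 0 j + q * h i0 * v 0 j - h j * one 0 i0).
  have := prop_eqE j i0 tX; rewrite !Eh -/s !Xj v0 mulr0 addr0.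
  have := prop_eqE j i0 sone; move: (ddir _ _ _ _) => D e1 e2.
  apply: (mulfI (pX_neq0 hZ k)); rewrite -/q.
  have -> : q * (D j * one 0 i0 - D i0 * one 0 j) =
    (s 0 j + q * D j + q ^+ 2 * h j) * one 0 i0 - s 0 j * one 0 i0
     - q ^+ 2 * h j * one 0 i0 - q * D i0 * one 0 j by ring.
  by rewrite e2 e1; ring.
move: (ddir t one y v) D_eq => D D_eq.
have key j : exists h', (D j * s 0 i0 - s 0 j * D i0) / s 0 i0 ^+ 2 =
    (one 0 i0)^-1 * v 0 j + q * h'.
  have e1 := prop_eqE j i0 sone; move: (D_eq j); set e := _ + _ - h j * _ => e2.
  exists ((one 0 i0)^-1 * (e / s 0 i0)); apply: (mulIr (unitrX 2 Us)); rewrite divrK ?unitrX //.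
  apply: (mulrI one_unit).
  have -> : one 0 i0 * (((one 0 i0)^-1 * v 0 j + q * ((one 0 i0)^-1 * (e / s 0 i0))) * s 0 i0 ^+ 2) =
    one 0 i0 / one 0 i0 * ((v 0 j + q * (e / s 0 i0)) * s 0 i0 ^+ 2) by ring.
  rewrite divrr // mul1r.
  have -> : one 0 i0 * (D j * s 0 i0 - s 0 j * D i0) =
    s 0 i0 * (D j * one 0 i0) - s 0 j * one 0 i0 * D i0 by ring.
  have -> : s 0 i0 * (D j * one 0 i0) - s 0 j * one 0 i0 * D i0 =
    s 0 i0 * (D j * one 0 i0 - D i0 * one 0 j) by rewrite e1; ring.
  by rewrite e2 -{1}[e](divrK Us); ring.
have [H EH] := fin_all_exists key; exists (\sum_j r 0 j * H j).
rewrite !mulr_sumr -big_split; apply: eq_bigr => j _.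
by rewrite EH /=; ring.
Qed.

(* Injectivity of the logarithm, quantitatively. *)
Lemma coleman_inj e a : cong 1 a 0 ->
  (forall j, exists r, coleman (basis_form j) a = tofrac (p%:R ^+ e * r)) -> cong e a 0.
Proof.
move=> a1 la; have [e0|e0] := posnP e; first by rewrite e0; apply: (cong_le _ a1).
suff h k : (0 < k)%N -> (k <= e)%N -> cong k a 0 by apply: h.
case: k => // k _; elim: k => [//|k IH] lt_ke.
have [u [u0 au]] := cong_coord hZ pp hG hi0 (ltn0Sn k) (IH (ltnW lt_ke)).
suff [u' Eu] : exists u', u = p%:R *: u'.
  apply: cong_sym; exists one, u'; split; first exact: at_0 hG.
  by move: au; rewrite Eu scalerA -exprSr.
suff key j : exists r, u 0 j = p%:R * r.
  have [r Er] := fin_all_exists key; exists (\row_j r j).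
  by apply/rowP=> j; rewrite !mxE.
have [t [f [ik [tF uF U]]]] := chart_at_one.
have [K hK] := coleman_local (inv_chart_omega (delta_mx 0 j) ik tF uF) (U _) 1.
(* Multiplication by p^K reaches the depth where the expansion of the integral is valid, and changes
   u only by a multiple of p. *)
have [v av] := coord_mulpX hJ hZ pp p2 hG hi0 K (ltn0Sn k) (conj u0 au).
have [r] := hK _ _ _ (leq_addl _ _) av.
have [|h ->] := inv_chart_one tF uF (U (delta_mx 0 j)) _ av; first by rewrite addSn.
rewrite (_ : \sum_i _ = u 0 j + p%:R * v 0 j); last first.
  rewrite (bigD1 j) //= big1 ?addr0 => [|i neq]; last by rewrite mxE (negPf neq) andbF mul0r.
  by rewrite !mxE !eqxx mul1r.
rewrite (additiveMn (colemanD _)) natrX tofrac_pX; have [z ->] := la j.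
rewrite -tofracM => /eqP; rewrite tofrac_eq => /eqP; rewrite addn1.
(* Since k + 2 <= e, the integral has one factor p more than the scale p^(k+1) of a; cancelling the
   common power leaves u_j divisible by p. *)
have -> : p%:R ^+ e = p%:R ^+ k.+2 * p%:R ^+ (e - k.+2) :> Zp by rewrite -exprD subnKC.
move=> E; have {}E : p%:R * p%:R ^+ (e - k.+2) * z =
    (one 0 i0)^-1 * (u 0 j + p%:R * v 0 j) + p%:R ^+ (k.+1 + K) * h + p%:R * r.
  apply: (mulfI (pX_neq0 hZ (k.+1 + K))); set P := p%:R ^+ (e - _) in E *.
  have -> : p%:R ^+ (k.+1 + K) * (p%:R * P * z) = p%:R ^+ K * (p%:R ^+ k.+2 * P * z).
    by rewrite exprD !exprS; ring.
  by rewrite E [p%:R ^+ (_ + K).+1]exprS; ring.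
exists (one 0 i0 * (p%:R ^+ (e - k.+2) * z - p%:R ^+ (k + K) * h - r) - v 0 j).
transitivity (one 0 i0 / one 0 i0 * (u 0 j + p%:R * v 0 j) - p%:R * v 0 j).
  by rewrite divrr // mul1r addrK.
transitivity (one 0 i0 * (p%:R * p%:R ^+ (e - k.+2) * z - p%:R ^+ (k.+1 + K) * h - p%:R * r)
    - p%:R * v 0 j); first by rewrite E; ring.
by rewrite addSn exprS; ring.
Qed.

(** At p^K a the integral is divisible by p^(K+1), and dividing by p^K keeps it integral. This
    bounds the error made when coefficients in [Zp] are replaced by natural numbers. *)
Lemma coleman_integral j a : cong 1 a 0 -> exists r, coleman (basis_form j) a = tofrac r.
Proof.
move=> a1; have [u au] := cong_coord hZ pp hG hi0 (ltn0Sn 0) a1.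
have [t [f [ik [tF uF U]]]] := chart_at_one.
have [K hK] := coleman_local (inv_chart_omega (delta_mx 0 j) ik tF uF) (U _) 0.
have [v av] := coord_mulpX hJ hZ pp p2 hG hi0 K (ltn0Sn 0) au.
have [r] := hK _ _ _ (leq_addl _ _) av; rewrite (additiveMn (colemanD _)) natrX.
set cv := chart_val _ _ _ _ => E; exists (p%:R * (cv + r)).
apply: (mulfI (Qp_pX_neq0 hZ pp K)); rewrite E tofrac_pX -tofracM addn0 add1n exprS.
by congr tofrac; ring.
Qed.

(** The integrals are supplied form by form, so linearity has to be proved: the difference of the
    two sides is a homomorphism whose differential at the origin is zero. *)
Lemma coleman_linear r a : coleman (omega r) a = \sum_j tofrac (r 0 j) * coleman (basis_form j) a.
Proof.
apply/eqP; rewrite -subr_eq0; apply/eqP.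
pose mu a := coleman (omega r) a - \sum_j tofrac (r 0 j) * coleman (basis_form j) a.
apply: (@additive_eq0 mu) => [b c|e].
  rewrite /mu colemanD; under eq_bigr => j _ do rewrite colemanD mulrDr.
  by rewrite big_split /=; ring.
have [t [f [ik [tF uF U]]]] := chart_at_one.
have [K hK] := coleman_local (inv_chart_omega r ik tF uF) (U _) e.
have [L hL] := fin_all_exists (fun j =>
  coleman_local (inv_chart_omega (delta_mx 0 j) ik tF uF) (U _) e).
exists (maxn K (\max_j L j)) => k b u; rewrite geq_max => /andP[Kk /bigmax_leqP Lk] bu.
have [s Es] := hK k b u Kk bu.
have [s' Es'] := fin_all_exists (fun j => hL j k b u (Lk j isT) bu).
exists (s - \sum_j r 0 j * s' j); rewrite /mu Es.
under eq_bigr => j _ do rewrite Es' -tofracM.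
rewrite -raddf_sum -tofracB; congr tofrac.
have Ecv : chart_val id (inv_chart i0 r t f ik) one u =
    \sum_j r 0 j * chart_val id (inv_chart i0 (delta_mx 0 j) t f ik) one u.
  apply: etrans (inv_chart_val u (U r)) _; apply: eq_bigr => j _; congr (_ * _).
  apply/esym; apply: etrans (inv_chart_val u (U _)) _.
  rewrite (bigD1 j) //= big1 ?addr0 => [|i neq]; last by rewrite mxE (negPf neq) andbF mul0r.
  by rewrite mxE !eqxx mul1r.
have gen (cv : 'I_m.+1 -> Zp) : p%:R ^+ k * (\sum_j r 0 j * cv j) + p%:R ^+ (k + e) * s -
    \sum_j r 0 j * (p%:R ^+ k * cv j + p%:R ^+ (k + e) * s' j) =
    p%:R ^+ (k + e) * (s - \sum_j r 0 j * s' j).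
  under [X in _ - X]eq_bigr => j _ do rewrite mulrDr !(mulrCA (r 0 j)).
  by rewrite big_split -!mulr_sumr /=; ring.
by rewrite Ecv; apply: gen.
Qed.
End Coleman.

(** * Saturation *)

(** Double annihilator for a set of vectors given by a predicate. Enlarging a finite subfamily
    raises its rank, which is at most n, so some subfamily spans; the columns of its cokernel matrix
    are the functionals that test v. *)
Lemma span_exists (F : fieldType) n (T : Type) (P : T -> Prop) (L : T -> 'rV[F]_n) (v : 'rV[F]_n) :
  (forall c : 'cV[F]_n, (forall x, P x -> L x *m c = 0) -> v *m c = 0) ->
  exists r (xs : 'I_r -> T) (c : 'I_r -> F),
    (forall i, P (xs i)) /\ v = \sum_i c i *: L (xs i).
Proof.
move=> hv; pose A r (xs : 'I_r -> T) := \matrix_i L (xs i).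
have [r [xs [Pxs spanP]]] : exists r (xs : 'I_r -> T),
    (forall i, P (xs i)) /\ forall x, P x -> (L x <= A r xs)%MS.
  suff h d : forall r (xs : 'I_r -> T), (forall i, P (xs i)) -> (n - \rank (A r xs) < d)%N ->
      exists r (xs : 'I_r -> T), (forall i, P (xs i)) /\ forall x, P x -> (L x <= A r xs)%MS.
    have x0 (i : 'I_0) : T by case: i.
    by apply: (h _ 0%N x0 _ (ltnSn _)) => -[].
  elim: d => // d IH r xs Pxs lt_d.
  have [[x [Px nx]]|none] := classic (exists x, P x /\ ~~ (L x <= A r xs)%MS); last first.
    exists r, xs; split=> // x Px; apply: contraPT none => nx; case.
    by exists x.
  pose ys i := if unlift ord0 i is Some j then xs j else x.
  have row0 : row ord0 (A r.+1 ys) = L x by rewrite rowK /ys unlift_none.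
  have rowS j : row (lift ord0 j) (A r.+1 ys) = L (xs j) by rewrite rowK /ys liftK.
  have sub : (A r xs <= A r.+1 ys)%MS.
    by apply/row_subP => j; rewrite rowK -rowS row_sub.
  have lt : (A r xs < A r.+1 ys)%MS.
    rewrite ltmxE sub; apply: contra nx => h; apply: submx_trans h.
    by rewrite -row0 row_sub.
  apply: (IH _ ys) => [i|]; first by rewrite /ys; case: unliftP.
  apply: leq_trans (ltn_sub2l _ (rank_ltmx lt)) _ => //.
  by apply: leq_trans (rank_ltmx lt) (rank_leq_col _).
have vA : (v <= A r xs)%MS.
  rewrite submxE; apply/eqP/rowP => j.
  have colE (u : 'rV[F]_n) : (u *m cokermx (A r xs)) 0 j = (u *m col j (cokermx (A r xs))) 0 0.
    by rewrite !mxE; apply: eq_bigr => k _; rewrite !mxE.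
  rewrite colE hv ?mxE // => x /spanP; rewrite submxE => /eqP Lx.
  by apply/rowP => k; rewrite ord1 -colE Lx !mxE.
have /submxP[D vD] := vA; exists r, xs, (D 0); split=> //.
by rewrite vD mulmx_sum_row; apply: eq_bigr => i _; rewrite rowK.
Qed.

Section Fractions.
Local Open Scope quotient_scope.
Lemma fraction_form (R : idomainType) (q : {fraction R}) :
  exists n d, d != 0 /\ q = tofrac n / tofrac d.
Proof.
elim/quotW: q => x; exists (\n_x), (\d_x); split; first exact: denom_ratioP.
have d0 := denom_ratioP x.
have U : tofrac \d_x != 0 by rewrite tofrac_eq0.
apply: (mulIf U); rewrite divfK //; unlock FracField.tofrac.
rewrite -[LHS]FracField.pi_mul; apply/eqmodP; rewrite /= FracField.equivfE.
by rewrite /FracField.mulf !numden_Ratio ?mulf_neq0 ?oner_neq0 // !mulr1 mulrC.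
Qed.
End Fractions.

Lemma common_denominator (R : idomainType) r (q : 'I_r -> {fraction R}) :
  exists d (n : 'I_r -> R), d != 0 /\ forall i, tofrac d * q i = tofrac (n i).
Proof.
have [n /fin_all_exists[d nd]] := fin_all_exists (fun i => fraction_form (q i)).
exists (\prod_i d i), (fun i => n i * \prod_(j | j != i) d j); split.
  by apply/prodf_neq0 => i _; case: (nd i).
move=> i; have [di ->] := nd i; rewrite (bigD1 i) //= !rmorphM /= mulrC mulrA divfK //.
by rewrite tofrac_eq0.
Qed.

Section Saturation.
Variables (p g m : nat) (J : group_data m) (Zp : idomainType) (red : {rmorphism Zp -> 'F_p}).
Hypotheses (hJ : abelian_scheme p g J) (hZ : is_padic_integers red) (pp : prime p) (p2 : (2 < p)%N).
Variables (G : zmodType) (rep : G -> 'rV[Zp]_m.+1).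
Hypothesis hG : is_point_group J rep.
Variable i0 : 'I_m.+1.
Hypothesis hi0 : ~~ (p%:Z %| gone J ord0 i0)%Z.
Variable integral : regular_form p (geqs J) Zp -> 'rV[Zp]_m.+1 -> Qp Zp.
Hypothesis hI : forall w, is_coleman_integral w (integral w).
Local Notation cong := (cong p rep).
Local Notation coleman := (coleman rep integral).
Local Notation basis_form := (basis_form Zp hJ pp hi0).

Lemma padic_valuation (x : Zp) : x != 0 -> exists k u, u \is a GRing.unit /\ x = p%:R ^+ k * u.
Proof.
move=> nz; have [//|h] := classic (exists k u, u \is a GRing.unit /\ x = p%:R ^+ k * u).
case/eqP: nz; apply: (padic_sep hZ) => k; elim: k => [|k [y Ey]].
  by exists x; rewrite expr0 mul1r.
have [Uy|/(padic_nonunitP hZ)[z Ez]] := boolP (y \is a GRing.unit).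
  by case: h; exists k, y.
by exists z; rewrite Ey Ez exprSr mulrA.
Qed.

(* The double annihilator of M_0 over Q_p, then approximation of the coefficients
   by natural numbers. *)
Lemma coleman_saturated D : cong 1 D 0 ->
  (forall nu, V integral nu -> coleman nu D = 0) -> exists k, M p J (rep (D *+ p ^ k)).
Proof.
move=> D1 hD; pose L a : 'rV[Qp Zp]_m.+1 := \row_j coleman (basis_form j) a.
have LE a (c : 'cV[Qp Zp]_m.+1) : (L a *m c) 0 0 = \sum_j c j 0 * coleman (basis_form j) a.
  by rewrite mxE; apply: eq_bigr => j _; rewrite mxE mulrC.
pose P a := M p J (rep a) /\ cong 1 a 0.
have lD w a b : coleman w (a + b) = coleman w a + coleman w b := colemanD hJ hZ pp hG hI w a b.
have l0 w : coleman w 0 = 0 := additive0 (lD w).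
have lMn w a n : coleman w (a *+ n) = n%:R * coleman w a := additiveMn (lD w) a n.
have [|r [xs [c [Pxs LD]]]] := span_exists (P := P) (L := L) (v := L D).
  (* A functional that kills log M_0, cleared of denominators, is the integral of an invariant form;
     it remains to see that this form belongs to [V]. *)
  move=> c hc; have [d [n [d0 dn]]] := common_denominator (fun j => c j 0).
  pose nu := inv_form hJ pp hi0 (\row_j n j).
  have lamE a : coleman nu a = tofrac d * (L a *m c) 0 0.
    rewrite (coleman_linear hJ hZ pp p2 hG hi0 hI) LE mulr_sumr; apply: eq_bigr => j _.
    by rewrite mxE -dn mulrA.
  have dn0 : tofrac d != 0 by rewrite tofrac_eq0.
  suff /eqP : coleman nu D = 0.
    rewrite lamE mulf_eq0 (negPf dn0) => /eqP e.
    by apply/rowP=> i; rewrite ord1 e mxE.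
  apply: hD => x Mx; have [a ax] := at_ex hG Mx.1; rewrite (coleman_at hJ hZ pp hG hI _ ax).
  have Ma : M p J (rep a) := M_at hJ hZ hG ax (at_rep hG a) Mx.
  (* [V] asks for vanishing on all of M, while c is controlled on M_0 only; a positive multiple of a
     lies in M_0, and Q_p has characteristic 0. *)
  have [N N0 aN] := torsion_mod_p hJ hZ pp hG a.
  have PaN : P (a *+ N) by split=> //; apply: (M_mul hJ hZ pp hG).
  have /eqP : coleman nu (a *+ N) = 0 by rewrite lamE hc // mxE mulr0.
  by rewrite lMn mulf_eq0 (negPf (Qp_nat_neq0 hZ pp N0)) => /eqP->; rewrite mulr0.
have [d [n [d0 dn]]] := common_denominator c.
(* The unit part of the common denominator is absorbed into the coefficients; its valuation k is the
   exponent of the saturation. *)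
have [k [u [Uu Ed]]] := padic_valuation d0.
have lDE j : p%:R ^+ k * coleman (basis_form j) D =
    \sum_i tofrac (n i / u) * coleman (basis_form j) (xs i).
  have := congr1 (fun v : 'rV_m.+1 => v 0 j) LD; rewrite mxE summxE => ->.
  rewrite mulr_sumr; apply: eq_bigr => i _; rewrite !mxE mulrA; congr (_ * _).
  have u0 : tofrac u != 0 by rewrite tofrac_eq0; apply: contraTneq Uu => ->; rewrite unitr0.
  apply: (mulfI u0); rewrite -tofracM [u * _]mulrC divrK // -dn Ed tofracM tofrac_pX.
  by rewrite mulrA [tofrac u * _]mulrC.
exists k; apply: (M_closed hJ hZ pp hG) => e e0.
(* With natural coefficients the combination becomes a point Y of M_0. The integrals of p^k D and Y
   agree modulo p^e, and [coleman_inj] turns this into closeness of the points. *)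
have [N /fin_all_exists[y Ny]] := fin_all_exists (fun i => nat_approx hZ (n i / u) e).
pose Y := \sum_i xs i *+ N i; exists Y.
  rewrite /Y; elim/big_ind: _ => [|a b|i _].
  - exact: (M_rational hJ hZ pp hG (rational_0 hJ hZ pp hG)).
  - exact: (M_add hJ hZ pp hG).
  by apply: (M_mul hJ hZ pp hG); case: (Pxs i).
have c0 k' a n' : cong k' a 0 -> cong k' (a *+ n') 0.
  by move/(cong_mul hJ hZ pp hG n'); rewrite mul0rn.
have Y1 : cong 1 Y 0.
  rewrite /Y; elim/big_ind: _ => [|a b a0 b0|i _].
  - exact: (cong_refl p hG).
  - by rewrite -[0]addr0; apply: (cong_add2 hJ hZ pp hG).
  by apply: c0; case: (Pxs i).
apply: (cong_sub0 hJ hZ pp hG _ _ _).2; apply: (coleman_inj (hJ := hJ) (hi0 := hi0) hZ p2 hG hI).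
  apply: (cong_sub0 hJ hZ pp hG _ _ _).1; apply: (cong_trans (c0 _ _ _ D1)).
  exact: cong_sym.
move=> j; have [z Ez] := fin_all_exists (fun i =>
  coleman_integral hJ hZ pp p2 hG hi0 hI j (Pxs i).2).
exists (\sum_i y i * z i).
have -> : coleman (basis_form j) (D *+ p ^ k - Y) =
    coleman (basis_form j) (D *+ p ^ k) - coleman (basis_form j) Y.
  by apply/eqP; rewrite eq_sym subr_eq -lD subrK.
have -> : coleman (basis_form j) Y = \sum_i (N i)%:R * coleman (basis_form j) (xs i).
  by rewrite /Y (big_morph _ (lD _) (l0 _)); apply: eq_bigr => i _.
rewrite lMn natrX lDE -sumrB mulr_sumr rmorph_sum; apply: eq_bigr => i _.
by rewrite -mulrBl Ny rmorphD rmorph_nat addrC addKr Ez -tofracM mulrA.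
Qed.
End Saturation.

Theorem theorem5p1 (p g r n m : nat)
    (Zp : idomainType) (red : {rmorphism Zp -> 'F_p})
    (C : seq {mpoly int[n.+1]}) (b : 'rV[int]_n.+1)
    (J : group_data m) (aj : morphism n.+1 m.+1)
    (integral : regular_form p (geqs J) Zp -> 'rV[Zp]_m.+1 -> Qp Zp) :
  prime p -> (2 < p)%N -> is_padic_integers red ->
  smooth_proj p 1 C -> irreducible_over C algC ->
  genus p C g -> (2 <= g)%N ->
  zpoint p C b ->
  abelian_scheme p g J -> is_jacobian p C b J aj ->
  mw_rank p Zp J r -> (r < g)%N ->
  (forall w, is_coleman_integral w (integral w)) ->
  [/\ forall P, rational_point p C P -> GLC red C J aj P,
      forall P, GLC red C J aj P -> CC C aj integral P
    & forall R : 'rV[Zp]_n.+1, CC C aj integral R -> ~ GLC red C J aj R ->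
        (forall j, mor_val aj R j ->
           ~ exists2 x, M p J x & reduces_to red x (map_mx red j))
        \/
        (forall j T D, mor_val aj R j -> rational_point p (geqs J) T ->
           reduces_to red T (map_mx red j) ->
           point (geqs J) Zp D -> add_rel J D T j ->
           ~ in_log integral (M0 red J) (padic_log integral D) /\
           in_log integral (N0 red J) (padic_log integral D))].
Proof.
move=> pp p2 hZ [_ hC _] _ _ _ _ hJ [hA _ _ _] _ _ hI.
have locZ := padic_local hZ pp; have hh := geqs_homog hJ.
have [G [rep hG]] : exists (G : zmodType) (rep : G -> 'rV[Zp]_m.+1), is_point_group J rep.
  exact: point_group hJ pp locZ.
have [i0 hi0] : exists i0, ~~ (p%:Z %| gone J ord0 i0)%Z by case: hJ => _ [].
have aj_point P j : point C Zp P -> mor_val aj P j -> point (geqs J) Zp j.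
  by move=> PP Pj; apply: (mor_val_point locZ hA.2 hh PP Pj).
(* The witnesses Q and q are the reductions of P and j; T is the rational point showing that the
   disk of q passes the sieve. *)
have glcI P j T : point C Zp P -> mor_val aj P j -> rational_point p (geqs J) T ->
    reduces_to red T (map_mx red j) -> M p J j -> GLC red C J aj P.
  move=> PP Pj RT Tj Mj; exists (map_mx red P), (map_mx red j).
  have refl k (x : 'rV[Zp]_k) : primitive x -> reduces_to red x (map_mx red x).
    by move=> /(map_primitive red)/prop_eq_refl[].
  split; first by split; [apply: map_point | apply: map_mor_val].
  - by exists T.
  - by split=> //; apply: refl (point_prim PP).
  by exists j; [exact: Pj | split; [exact: Mj | exact: (refl _ _ (point_prim Mj.1))]].
have Qpp : p%:R != 0 :> Qp Zp by apply: (Qp_nat_neq0 hZ pp); apply: prime_gt0.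
have lE w a x : prop_eq (rep a) x -> integral w x = coleman rep integral w a.
  exact: (coleman_at hJ hZ pp hG hI).
have lD w x y :
    coleman rep integral w (x + y) = coleman rep integral w x + coleman rep integral w y.
  exact: (colemanD hJ hZ pp hG hI).
split=> [P RP|P [Q [q [_ _ [PP _] [j Pj [Mj _]]]]]|R [PR CR] nGLC].
- have [j Pj] := mor_val_ex locZ hA.2 RP.1.
  have Rj := rational_proj hZ pp hC hh hA RP Pj.
  apply: (glcI P j j) => //; first exact: RP.1.
    by have [] := prop_eq_refl (map_primitive red (point_prim Rj.1)).
  have [a aj'] := at_ex hG Rj.1; apply: (M_at hJ hZ hG (at_rep hG a) aj').
  apply: (M_rational hJ hZ pp hG); exact: (rational_prop hZ pp hh (prop_eq_sym aj') Rj).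
(* [CC] ranges over all coordinate vectors j' of the image of P, so membership in M has to be
   carried over from j to j'. *)
- split=> // nu j' Vnu Pj'; apply: Vnu.
  have [a aj'] := at_ex hG Mj.1; apply: (M_at hJ hZ hG aj' _ Mj).
  apply: (at_trans aj').
  exact: (proj_val_uniq locZ hA PP (prop_eq_refl (point_prim PP)) Pj Pj').
(* The second alternative quantifies over the rational points T in the disk of R - b and holds
   vacuously when there are none; from here on such a T is given, with D = R - b - T. *)
right=> j T D Rj RT Tj PD DTj.
have [a ajj] := at_ex hG (aj_point _ _ PR Rj).
have [t tT] := at_ex hG RT.1; have [d dD] := at_ex hG PD.
have Ea : a = d + t.
  by apply: (at_inj hG ajj ((at_add hJ hZ pp hG j dD tT).2 DTj)); apply: prop_eq_refl; case: ajj.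
have d0 : cong p rep 1 d 0.
  have ta : cong p rep 1 t a by apply/(padic_closeP hJ hZ hG 1 tT ajj)/(reduces_toP hZ).
  have := (cong_sub0 hJ hZ pp hG 1 a t).1 (cong_sym ta); by rewrite Ea addrK.
have Mt : M p J (rep t).
  apply: (M_rational hJ hZ pp hG); exact: (rational_prop hZ pp hh (prop_eq_sym tT) RT).
split=> [[x [Mx J0x] lx]|].
  apply: nGLC; apply: (glcI R j T) => //.
  have [c cx] := at_ex hG Mx.1; have Mc : M p J (rep c) := M_at hJ hZ hG cx (at_rep hG c) Mx.
  have c0 : cong p rep 1 c 0 := (J0P hJ hZ hG cx).1 J0x.
  have lam0 w : coleman rep integral w (d - c) = 0.
    apply: (addIr (coleman rep integral w c)); rewrite -lD subrK add0r.
    rewrite -(lE _ _ _ dD) -(lE _ _ _ cx).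
    by apply: (mulfI (invr_neq0 Qpp)); apply: lx.
  apply: (M_at hJ hZ hG (at_rep hG a) ajj); rewrite Ea; apply: (M_add hJ hZ pp hG _ Mt).
  (* All integrals of d - c vanish, so c approximates d to every precision; thus R - b, being d + t,
     lies in M, contradicting the choice of R. *)
  apply: (M_closed hJ hZ pp hG) => e e0; exists c => //.
  apply: (cong_sub0 hJ hZ pp hG _ _ _).2.
  apply: (coleman_inj (hJ := hJ) (hi0 := hi0) hZ p2 hG hI) => [|i].
    apply: (cong_sub0 hJ hZ pp hG _ _ _).1; exact: cong_trans d0 (cong_sym c0).
  by exists 0; rewrite mulr0 rmorph0 lam0.
exists D; last by move=> w.
split; first exact: ((J0P hJ hZ hG dD).2 d0).
(* Forms in [V] integrate to zero over R - b because R lies in [CC], and over T because T lies in M;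
   hence also over D. *)
have [nu Vnu|k Mk] := coleman_saturated hJ hZ pp p2 hG hi0 hI d0.
  have lt : coleman rep integral nu t = 0.
    by apply: (mulfI (invr_neq0 Qpp)); rewrite mulr0; apply: Vnu.
  have : coleman rep integral nu a = 0.
    by apply: (mulfI (invr_neq0 Qpp)); rewrite mulr0 -(lE _ _ _ ajj); apply: CR.
  by rewrite Ea lD lt addr0.
exists k, (rep (d *+ p ^ k)); split; first exact: (at_sum hJ hZ pp hG dD (at_rep hG _)).
split; first exact: Mk.
have := cong_mul hJ hZ pp hG (p ^ k) d0; rewrite mul0rn.
exact: (J0P hJ hZ hG (at_rep hG _)).2.
Qed.
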